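(* Let $n\ge 1$ and let $f:(\mathbb{C}^n,0)\to(\mathbb{C},0)$ be a holomorphic function germ with $f(0)=0$ such that the origin is an isolated critical point of $f$. Let $\mu=\dim_{\mathbb{C}} M_f$ and $\tau=\dim_{\mathbb{C}} T_f$ be its Milnor and Tjurina numbers. Then $$\frac{\mu}{\tau}\le n .$$ Moreover, $\mu/\tau=n$ if and only if $\ker(f)=(f^{n-1})$, where $\ker(f)$ is the kernel of the multiplication-by-$f$ map $M_f\to M_f$ and $(f^{n-1})$ denotes the ideal of $M_f$ generated by the class of $f^{n-1}$.
   Context: Let $S=\mathbb{C}\{x_1,\dots,x_n\}$ be the ring of convergent power series, and $J_f=(\partial f/\partial x_1,\dots,\partial f/\partial x_n)\subset S$ the Jacobian ideal. The Milnor algebra is $M_f=S/J_f$ and the Tjurina algebra is $T_f=S/(J_f,f)$; since the critical point is isolated, both are finite-dimensional over $\mathbb{C}$, and $\mu=\dim_{\mathbb{C}}M_f$, $\tau=\dim_{\mathbb{C}}T_f$ (so $\tau\ge 1$). *)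

(* Defs.v *)
From HB Require Import structures.
From mathcomp Require Import all_boot all_order all_algebra.
From mathcomp Require Import complex.
From mathcomp Require Import all_classical all_reals.
Set Implicit Arguments. Unset Strict Implicit. Unset Printing Implicit Defensive.
Import Order.TTheory GRing.Theory Num.Theory.
Local Open Scope classical_set_scope.
Local Open Scope ring_scope.

Definition mi (n : nat) := {ffun 'I_n -> nat}.
Definition ps (C : Type) (n : nat) := mi n -> C.

Definition mdeg n (a : mi n) : nat := (\sum_i a i)%N.
Definition mi0 n : mi n := [ffun _ => 0%N].

Section PowerSeries.
Variables (R : realType) (n : nat).
Local Notation C := (R[i]).
Local Notation PS := (ps C n).

(* Cauchy product: (f g)_c = sum_{b <= c} f_b g_{c-b}
   (b ranges over multi-indices with b_i <= c_i, all bounded by |c|). *)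
Definition ps_mul (f g : PS) : PS := fun c =>
  \sum_(b : {ffun 'I_n -> 'I_(mdeg c).+1} | [forall i, (b i <= c i)%N])
     f [ffun i => nat_of_ord (b i)] * g [ffun i => (c i - b i)%N].

Definition ps_one : PS := fun c => (mdeg c == 0%N)%:R.
Definition ps_exp (f : PS) (k : nat) : PS := iter k (ps_mul f) ps_one.

Definition ps_deriv (i : 'I_n) (f : PS) : PS :=
  fun c => (c i).+1%:R * f [ffun j => (c j + (j == i))%N].

Definition ps_conv (f : PS) : Prop :=
  exists r : R, 0 < r /\ exists M : R, forall c, ComplexField.Normc.normc (f c) * r ^+ mdeg c <= M.

Definition ps_psum (f : PS) (z : 'I_n -> C) (N : nat) : C :=
  \sum_(b : {ffun 'I_n -> 'I_N.+1} | (\sum_i nat_of_ord (b i) <= N)%N)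
     f [ffun i => nat_of_ord (b i)] * \prod_i z i ^+ b i.

Definition ps_sum_to (f : PS) (z : 'I_n -> C) (v : C) : Prop :=
  forall e : R, 0 < e -> exists N : nat, forall m : nat, (N <= m)%N ->
    ComplexField.Normc.normc (ps_psum f z m - v) < e.

Definition isolated_crit (f : PS) : Prop :=
  (forall i, ps_deriv i f (mi0 n) = 0) /\
  exists eps : R, 0 < eps /\
    forall z : 'I_n -> C, (forall i, ComplexField.Normc.normc (z i) < eps) ->
      (forall i, ps_sum_to (ps_deriv i f) z 0) ->
      forall i, z i = 0.

Definition jac_ideal (f : PS) (g : PS) : Prop :=
  exists h : 'I_n -> PS, (forall i, ps_conv (h i)) /\
    forall c, g c = \sum_i ps_mul (h i) (ps_deriv i f) c.

Definition tjurina_ideal (f : PS) (g : PS) : Prop :=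
  exists (h : 'I_n -> PS) (h0 : PS), (forall i, ps_conv (h i)) /\ ps_conv h0 /\
    forall c, g c = \sum_i ps_mul (h i) (ps_deriv i f) c + ps_mul h0 f c.

Definition quot_dim (I : PS -> Prop) (d : nat) : Prop :=
  exists e : 'I_d -> PS, (forall k, ps_conv (e k)) /\
    (forall g, ps_conv g -> exists x : 'I_d -> C,
        I (fun c => g c - \sum_k x k * e k c)) /\
    (forall x : 'I_d -> C, I (fun c => \sum_k x k * e k c) -> forall k, x k = 0).

Definition ker_eq_pow (f : PS) : Prop :=
  forall g, ps_conv g ->
    (jac_ideal f (ps_mul f g) <->
     exists h, ps_conv h /\
       jac_ideal f (fun c => g c - ps_mul h (ps_exp f n.-1) c)).

End PowerSeries.

(* Main.v *)
(* The key point is that f^n lies in the Jacobian ideal J.  Since J contains every convergent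
   series of high order, f may be replaced by a polynomial F, and adding sum_i x_i^(M+2) / (M+2)
   with M large makes x_i^(M+1) the leading form of the i-th partial derivative P_i of F.  Then
   K[x] is free of finite rank over K[P_1, ..., P_n].  On a generic line through the origin of
   the space of values of P, the traces of the powers of the multiplication by F satisfy a
   differential identity (the gradient of F is divisible by the parameter t of the line) which
   forces the slopes of its characteristic polynomial to be at least 1.  Hence F, up to a unit,
   is a root w of w^s = sum_(j < s) a_j(P) w^j with a_j of order at least s - j.
   If w^n were not in the ideal (P) up to high order, a linear functional would separate the two.
   All these data are defined over a finitely generated ring, which maps to a field of large
   characteristic p.  There w^s w^(np) belongs to (P)^(np), which lies in the ideal generated by
   the P_i^p; projecting on a basis of the polynomials over their p-th powers gives w^n in (P),
   a contradiction.

   So the multiplication A by f on the Milnor algebra satisfies A^n = 0, and mu is the sum of the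
   dimensions of ker A /\ im A^k for 0 <= k < n.  Each of them is at most tau = dim ker A, with
   equality for all k if and only if ker A = im A^(n-1). *)
Require Import Defs.
From HB Require Import structures.
From mathcomp Require Import all_boot all_order all_algebra.
From mathcomp Require Import zify ring lra.
Set Implicit Arguments. Unset Strict Implicit. Unset Printing Implicit Defensive.
Import Order.TTheory GRing.Theory Num.Theory.
Local Open Scope ring_scope.

(** * Orders of characteristic polynomials *)

(** Integrality of F over (P) is usually tested on arcs, along which F vanishes at least as fast as
    its gradient. Traces of multiplication matrices replace arcs, so that no branch of x as an
    algebraic function of P has to be chosen. On the line P = t u the convenient element is not F
    but, up to sign, its Legendre transform G = F - t sum_j u_j x_j, for which formally dG/dt = -
    sum_j u_j x_j; F and G differ by a multiple of t, which does not spoil slopes at least 1.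
    Polynomials serve two purposes: the map P becomes finite and free globally, and finitely many
    scalars describe all the data, as reduction modulo p requires. The price is critical points away
    from the origin; the unit removes their nonzero critical values. Non-membership in an ideal need
    not survive reduction modulo p, whereas the finitely many equations satisfied by a separating
    functional do. The step from integrality to w^n in (P) is the Briancon-Skoda theorem, by the
    method of tight closure. *)

Lemma deriv_prod (R : comNzRingType) (d : R -> R) (I : finType) (F : I -> R) :
  (forall x y, d (x * y) = d x * y + x * d y) -> d 1 = 0 ->
  d (\prod_i F i) = \sum_i d (F i) * \prod_(j | j != i) F j.
Proof.
move=> dM d1.
have gen (s : seq I) : uniq s ->
    d (\prod_(i <- s) F i) = \sum_(i <- s) d (F i) * \prod_(j <- s | j != i) F j.
  elim: s => [|x s IHs] /=; first by rewrite !big_nil.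
  case/andP=> xs us; rewrite !big_cons dM IHs // eqxx /=; congr (_ * _ + _).
    by rewrite big_seq_cond [RHS]big_seq_cond; apply: eq_bigl => i; case: eqP => [->|]; rewrite ?(negPf xs) ?andbT.
  rewrite mulr_sumr [LHS]big_seq [RHS]big_seq; apply: eq_bigr => i si.
  rewrite big_cons; case: eqP => [xi|_]; first by rewrite xi si in xs.
  by rewrite mulrCA.
by rewrite -!big_enum gen ?enum_uniq //; apply: eq_bigr => i _; rewrite big_enum_cond.
Qed.

(** Jacobi's formula. It is stated for an arbitrary derivation because it is applied to the
    coefficientwise derivation of polynomials in the characteristic variable. *)
Lemma deriv_det (R : comNzRingType) (d : {additive R -> R}) n (A : 'M[R]_n) :
  (forall x y, d (x * y) = d x * y + x * d y) ->
  d (\det A) = \tr (\adj A *m map_mx d A).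
Proof.
move=> dM.
have d1 : d 1 = 0.
  by apply: (addrI (d 1)); rewrite addr0 -{3}[1]mulr1 dM !(mulr1, mul1r).
have dN (b : bool) x : d ((-1) ^+ b * x) = (-1) ^+ b * d x.
  by case: b; rewrite ?expr1 ?expr0 ?mul1r // !mulN1r raddfN.
pose Ai i := \matrix_(k, l) if k == i then d (A k l) else A k l : R.
have -> : d (\det A) = \sum_i \det (Ai i).
  rewrite /determinant raddf_sum /= exchange_big /=; apply: eq_bigr => s _.
  rewrite dN (deriv_prod _ dM d1) mulr_sumr; apply: eq_bigr => i _; congr (_ * _).
  rewrite [RHS](bigD1 i) //= mxE eqxx; congr (_ * _).
  by apply: eq_bigr => j /negPf ji; rewrite mxE ji.
rewrite mxtrace_mulC /mxtrace; apply: eq_bigr => i _.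
rewrite (expand_det_row _ i) mxE; apply: eq_bigr => j _.
rewrite !mxE eqxx; congr (_ * (_ * \det _)).
by apply/matrixP => k l; rewrite !mxE eq_sym (negPf (neq_lift _ _)).
Qed.

Lemma horner_char_poly (R : comNzRingType) n (A : 'M[R]_n) a :
  (char_poly A).[a] = \det (a%:M - A).
Proof.
rewrite -horner_evalE -det_map_mx; congr (\det _); apply/matrixP => i j.
rewrite /char_poly_mx !mxE /= /horner_eval.
by rewrite hornerD hornerN hornerC hornerMn hornerX.
Qed.

(** * Matrices divisible by a power of the variable *)

Section XnDvd.
Variables (D : comNzRingType) (r : nat).
Implicit Types A B : 'M[{poly D}]_r.+1.

Definition Xn_dvdmx k A := exists B, A = 'X^k *: B.

Lemma Xn_dvdmx0 k : Xn_dvdmx k 0.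
Proof. by exists 0; rewrite scaler0. Qed.

Lemma Xn_dvdmxD k A B : Xn_dvdmx k A -> Xn_dvdmx k B -> Xn_dvdmx k (A + B).
Proof. by case=> A' -> [B' ->]; exists (A' + B'); rewrite scalerDr. Qed.

Lemma Xn_dvdmx_sum k (I : Type) (s : seq I) (P : pred I) (F : I -> 'M_r.+1) :
  (forall i, P i -> Xn_dvdmx k (F i)) -> Xn_dvdmx k (\sum_(i <- s | P i) F i).
Proof. by move=> H; elim/big_ind: _ => //; [apply: Xn_dvdmx0 | apply: Xn_dvdmxD]. Qed.

Lemma Xn_dvdmxM k l A B : Xn_dvdmx k A -> Xn_dvdmx l B -> Xn_dvdmx (k + l) (A * B).
Proof.
case=> A' -> [B' ->]; exists (A' * B').
by rewrite exprD -scalerA -scalerAl -scalerAr scalerA -!scalerA.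
Qed.

Lemma Xn_dvdmxMr k A B : Xn_dvdmx k A -> Xn_dvdmx k (A * B).
Proof. by case=> A' ->; exists (A' * B); rewrite scalerAl. Qed.

Lemma Xn_dvdmxZ k p A : Xn_dvdmx k A -> Xn_dvdmx k (p *: A).
Proof. by case=> A' ->; exists (p *: A'); rewrite !scalerA mulrC. Qed.

Lemma Xn_dvdmx_le k l A : (l <= k)%N -> Xn_dvdmx k A -> Xn_dvdmx l A.
Proof.
by move=> lk [B ->]; exists ('X^(k - l) *: B); rewrite scalerA -exprD subnKC.
Qed.

Lemma Xn_dvdmxN k A : Xn_dvdmx k A -> Xn_dvdmx k (- A).
Proof. by rewrite -scaleN1r; apply: Xn_dvdmxZ. Qed.

Lemma Xn_dvdmxZX k l p A : Xn_dvdmx k A -> Xn_dvdmx (l + k) (p * 'X^l *: A).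
Proof.
by case=> B ->; exists (p *: B); rewrite !scalerA exprD; congr (_ *: _); ring.
Qed.

End XnDvd.

Section Order.
Variable D : idomainType.
Hypothesis char0 : forall k, k.+1%:R != 0 :> D.

Lemma nat_inj_char0 : injective (fun k : nat => k%:R : D).
Proof.
move=> i j /= ij; wlog lij : i j ij / (i <= j)%N.
  by move=> H; case/orP: (leq_total i j) => /H -> //; rewrite ij.
have: (j - i)%:R = 0 :> D by rewrite natrB // ij subrr.
by case E : (j - i)%N => [|k] /eqP; [lia | rewrite (negPf (char0 k))].
Qed.

Lemma poly_nat_roots0 (p : {poly D}) : (forall k : nat, p.[k%:R] = 0) -> p = 0.
Proof.
move=> p0; apply/eqP; apply/negPn/negP => pn0.
have := max_poly_roots (rs := [seq k%:R | k <- iota 0 (size p)]) pn0.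
rewrite size_map size_iota ltnn => H; suff: false by [].
apply: H; first by apply/allP => _ /mapP [k _ ->]; rewrite rootE p0.
by rewrite map_inj_uniq ?iota_uniq //; apply: nat_inj_char0.
Qed.

Lemma Xn_factorP k (p : {poly D}) :
  (forall l, (l < k)%N -> p`_l = 0) <-> exists g, p = g * 'X^k.
Proof.
split=> [H|[g -> l lk]]; last by rewrite coefMXn lk.
exists (drop_poly k p); rewrite -[LHS](poly_take_drop k).
rewrite (_ : take_poly k p = 0) ?add0r //.
by apply/polyP => i; rewrite coef_take_poly coef0; case: ifP => // /H.
Qed.

(* A power-bounded estimate loses the bounded defect [c] when it is fed with all the powers. *)
Lemma Xn_dvd_of_powers c e (d : {poly D}) :
  (forall m, exists g, 'X^c * d ^+ m = g * 'X^(e * m)) -> exists g, d = g * 'X^e.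
Proof.
move=> H; have [->|dn0] := eqVneq d 0; first by exists 0; rewrite mul0r.
have [k [h]] := multiplicity_XsubC d 0; rewrite dn0 /= subr0 => h0 dE.
case: (leqP e k) => ek; first by exists (h * 'X^(k - e)); rewrite -mulrA -exprD subnK.
have [g] := H c.+1; rewrite dE exprMn -exprM mulrCA -exprD => /(congr1 (fun p : {poly D} => p`_(c + k * c.+1))).
rewrite !coefMXn.
rewrite ltnn subnn; case: ltnP => [_|]; last by nia.
by rewrite -horner_coef0 horner_exp => /eqP; rewrite expf_eq0 /=; rewrite rootE in h0; rewrite (negPf h0).
Qed.

Variable r : nat.
Implicit Types N Z : 'M[{poly D}]_r.+1.

(** The power estimate passes from [N] to [k 'X^e - N], whose determinant therefore has order at
    least e (r + 1), the defect [c] being absorbed by [Xn_dvd_of_powers]. Letting the integer k vary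
    separates the coefficients of the characteristic polynomial. *)
Lemma char_poly_Xn_dvd c e N :
  (forall m, Xn_dvdmx (e * m) ('X^c *: N ^+ m)) ->
  forall j, exists g, (char_poly N)`_j = g * 'X^(e * (r.+1 - j)).
Proof.
move=> H.
have detP (k : nat) : exists g, (char_poly N).[k%:R *: 'X^e] = g * 'X^(e * r.+1).
  rewrite horner_char_poly; set A := _ - _.
  apply: (Xn_dvd_of_powers (c := c * r.+1)) => m.
  suff [B AB] : Xn_dvdmx (e * m) ('X^c *: A ^+ m).
    exists (\det B); move/(congr1 determinant): AB; rewrite !detZ -!exprM => AB.
    have dX : \det (A ^+ m) = \det A ^+ m.
      by elim: (m) => [|i IHi]; rewrite ?expr0 ?det1 // !exprS -IHi -det_mulmx.
    by rewrite -dX AB mulrC; congr (_ * 'X^_); lia.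
  have cAN : GRing.comm (k%:R *: 'X^e)%:M (- N).
    by apply/commrN; rewrite /GRing.comm -!mulmxE scalar_mxC.
  rewrite /A exprDn_comm // scaler_sumr; apply: Xn_dvdmx_sum => i _.
  rewrite -mulr_natr scalerAl; apply: Xn_dvdmxMr.
  have [B BE] := H i.
  exists ((k%:R ^+ (m - i))%:P *: ((-1) ^+ i *: B)).
  have -> : ((k%:R *: 'X^e)%:M : 'M[{poly D}]_r.+1) ^+ (m - i) =
      (k%:R ^+ (m - i) *: 'X^(e * (m - i)))%:M.
    by rewrite -rmorphXn /= exprZn -exprM.
  rewrite -(scaleN1r N) exprZn -mulmxE mul_scalar_mx -mul_polyC.
  set a := _%:P; rewrite [LHS](_ : _ = (a * 'X^(e * (m - i)) * (-1) ^+ i) *: ('X^c *: N ^+ i)).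
    rewrite BE !scalerA (_ : e * m = e * (m - i) + e * i)%N; last first.
      by rewrite -mulnDr subnK // -ltnS.
    by congr (_ *: _); rewrite exprD; ring.
  by rewrite !scalerA; congr (_ *: _); ring.
move=> j; case: (ltnP r j) => rj.
  by exists (char_poly N)`_j; rewrite (_ : r.+1 - j = 0)%N ?muln0 ?mulr1 //; lia.
(* As a polynomial in k, [q l] is the coefficient of ['X^l] in the characteristic polynomial
   evaluated at [k 'X^e]. *)
pose q (l : nat) : {poly D} :=
  \sum_(i < r.+2) (if (e * i <= l)%N then ((char_poly N)`_i)`_(l - e * i) else 0) *: 'X^i.
have q0 l : (l < e * r.+1)%N -> q l = 0.
  move=> le; apply: poly_nat_roots0 => k; have [g] := detP k.
  rewrite (horner_coef_wide _ (n := r.+2)) ?size_char_poly // => /(congr1 (fun p : {poly D} => p`_l)).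
  rewrite coefMXn le coef_sum => <-; rewrite horner_sum; apply: eq_bigr => i _.
  rewrite !hornerE exprZn -exprM -scalerAr coefZ coefMXn mulrC ltnNge; case: leqP => //= _.
have le l : (l < e * (r.+1 - j))%N -> (l + e * j < e * r.+1)%N by nia.
apply/Xn_factorP => l /le lj; have /(congr1 (fun p : {poly D} => p`_j)) := q0 _ lj.
rewrite coef0 coef_sum (bigD1 (inord j)) //= inordK; last by lia.
rewrite leq_addl addnK coefZ coefXn eqxx mulr1 big1 ?addr0 //.
move=> i /negP ij; rewrite coefZ coefXn; case: eqP => [ji|_]; rewrite ?mulr0 //.
by case: ij; apply/eqP/val_inj; rewrite /= inordK -?ji //; lia.
Qed.

(** Converse estimate: Cayley-Hamilton rewrites a high power by lower ones, each factor supplying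
    the missing order. The constant [b * r.+1] pays for the powers m <= r, where the equation cannot
    be used. *)
Lemma powers_Xn_dvd b N :
  (forall j, exists g, (char_poly N)`_j = g * 'X^(b * (r.+1 - j))) ->
  forall m, Xn_dvdmx (b * m) ('X^(b * r.+1) *: N ^+ m).
Proof.
move=> H m; elim/ltn_ind: m => m IHm.
case: (ltnP r m) => rm; last first.
  by apply: (@Xn_dvdmx_le _ _ (b * r.+1)%N); [nia | exists (N ^+ m)].
have := Cayley_Hamilton N; rewrite /horner_mx /horner_morph.
rewrite (horner_coef_wide _ (n := r.+2)); last first.
  by rewrite -(size_char_poly N) size_poly.
rewrite big_ord_recr /= coef_map /= (_ : (char_poly N)`_r.+1 = 1); last first.
  by have := char_poly_monic N; rewrite monicE lead_coefE size_char_poly => /eqP.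
rewrite mul1r addrC => /eqP; rewrite addr_eq0 => /eqP NE.
rewrite -(subnKC rm); set m' := (m - _)%N.
rewrite exprD NE mulNr scalerN; apply: Xn_dvdmxN.
rewrite mulr_suml scaler_sumr; apply: Xn_dvdmx_sum => i _.
rewrite coef_map /= -mulrA -exprD -mulmxE mul_scalar_mx scalerA mulrC -scalerA.
have [g ->] := H i.
have -> : (b * (r.+1 + m') = b * (r.+1 - i) + b * (i + m'))%N.
  by rewrite -mulnDr; congr (_ * _)%N; have := ltn_ord i; lia.
by apply: Xn_dvdmxZX; apply: IHm; rewrite /m'; have := ltn_ord i; lia.
Qed.

(** Bounding [N ^+ k] directly would lose the constant of [powers_Xn_dvd]. Since N and Z commute,
    all powers of [N ^+ k * Z] obey an estimate with the same constant, and the trace is a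
    coefficient of the characteristic polynomial of that matrix. *)
Lemma trace_Xn_dvd b N Z k : GRing.comm N Z ->
  (forall j, exists g, (char_poly N)`_j = g * 'X^(b * (r.+1 - j))) ->
  exists g, \tr (N ^+ k * Z) = g * 'X^(b * k).
Proof.
move=> cNZ /powers_Xn_dvd H.
have [|g] := @char_poly_Xn_dvd (b * r.+1) (b * k) (N ^+ k * Z) _ r.
  move=> m; rewrite exprMn_comm; last by apply/commr_sym/commrX/commr_sym.
  by rewrite -exprM scalerAl -mulnA; apply: Xn_dvdmxMr.
have -> : (char_poly (N ^+ k * Z))`_r = - \tr (N ^+ k * Z) by apply: char_poly_trace.
by rewrite subSnn muln1 => /eqP; rewrite eqr_oppLR => /eqP ->; exists (- g); rewrite mulNr.
Qed.

(* Orders are measured in fractions with denominator [q] by substituting ['X^q] for ['X]. *)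
Lemma trace_coef0 q b N Z k l : (0 < q)%N -> GRing.comm N Z ->
  (forall j i, (q * i < b * (r.+1 - j))%N -> ((char_poly N)`_j)`_i = 0) ->
  (q * l < b * k)%N -> (\tr (N ^+ k * Z))`_l = 0.
Proof.
move=> q0 cNZ H ql; pose f := comp_poly 'X^q : {poly D} -> {poly D}.
have fE p i : (p \Po 'X^q)`_(q * i) = p`_i.
  by rewrite coef_comp_poly_Xn // dvdn_mulr // mulKn.
have [||g trE] := @trace_Xn_dvd b (map_mx f N) (map_mx f Z) k.
- by rewrite /GRing.comm -!rmorphM cNZ.
- move=> j; rewrite -map_char_poly coef_map /=; apply/Xn_factorP => i ib.
  rewrite coef_comp_poly_Xn //; case: ifP => // /dvdnP [i' iE].
  by rewrite iE mulnK // H // mulnC -iE.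
have trM M : (\tr M) \Po 'X^q = \tr (map_mx f M) by rewrite trace_map_mx.
by rewrite -fE trM rmorphM rmorphXn /= trE coefMXn ql.
Qed.

Local Notation c := (map_mx (@polyC {poly D})).

(** Jacobi's formula for the characteristic matrix X - N, whose adjugate is the difference quotient
    of chi(X) - chi(N) by X - N. *)
Lemma char_poly_deriv N j :
  ((char_poly N)`_j)^`() =
  - \sum_(k < r.+2 | (j < k)%N) (char_poly N)`_k * \tr (N ^+ (k - j.+1) * map_mx (@deriv D) N).
Proof.
pose N' := map_mx (@deriv D) N; rewrite -/N'.
pose x : 'M[{poly {poly D}}]_r.+1 := 'X%:M.
have adjE : \adj (char_poly_mx N) =
    \sum_(k < r.+2) \sum_(i < k) (((char_poly N)`_k)%:P * 'X^(k.-1 - i)) *: c N ^+ i.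
  have xE m : x ^+ m = ('X^m)%:M by rewrite [RHS]rmorphXn.
  have chi0 : char_poly N != 0 by apply: monic_neq0; apply: char_poly_monic.
  set C := \sum_(k < _) _.
  have xcN : GRing.comm x (c N) by rewrite /GRing.comm -!mulmxE scalar_mxC.
  have CE : char_poly_mx N *m C = (char_poly N)%:M.
    have -> : C = \sum_(k < r.+2) ((char_poly N)`_k)%:P *: \sum_(i < k) (x ^+ (k.-1 - i) * c N ^+ i).
      apply: eq_bigr => k _; rewrite scaler_sumr; apply: eq_bigr => i _.
      rewrite -scalerA; congr (_ *: _).
      by rewrite xE -mulmxE mul_scalar_mx.
    rewrite mulmxE mulr_sumr; transitivity (\sum_(k < r.+2) ((char_poly N)`_k)%:P *: (x ^+ k - c N ^+ k)).
      apply: eq_bigr => k _; rewrite -scalerAr; congr (_ *: _).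
      by rewrite subrXX_comm.
    have CH : \sum_(k < r.+2) ((char_poly N)`_k)%:P *: c N ^+ k = 0.
      have /(congr1 (fun M : 'M[{poly D}]_r.+1 => c M)) := Cayley_Hamilton N; rewrite raddf0 => CH; rewrite -[RHS]CH.
      rewrite /horner_mx /horner_morph (horner_coef_wide _ (n := r.+2)); last first.
        by rewrite -(size_char_poly N) size_poly.
      rewrite raddf_sum; apply: eq_bigr => k _.
      by rewrite coef_map /= -mulmxE mul_scalar_mx map_mxZ rmorphXn.
    under eq_bigr do rewrite scalerBr; rewrite sumrB CH subr0.
    rewrite -[in RHS](coefK (char_poly N)) size_char_poly poly_def raddf_sum; apply: eq_bigr => k _.
    by rewrite xE scale_scalar_mx -mul_polyC.
  (* Both matrices have the product chi with the characteristic matrix, and chi is a nonzero element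
     of a domain, so it cancels. *)
  have : (char_poly N) *: (\adj (char_poly_mx N) - C) = 0.
    by rewrite scalerBr -!mul_scalar_mx -{2}mul_adj_mx -mulmxA CE mul_scalar_mx scalar_mxC mul_scalar_mx subrr.
  move/eqP; rewrite scalemx_eq0 (negPf chi0) subr_eq0 => /eqP ->.
  by apply: eq_bigr => k _.
pose d : {additive {poly {poly D}} -> {poly {poly D}}} := map_poly (@deriv D).
have dE (p : {poly {poly D}}) k : (d p)`_k = (p`_k)^`() by rewrite coef_map.
have dM (p q : {poly {poly D}}) : d (p * q) = d p * q + p * d q.
  apply/polyP => k; rewrite coefD dE !coefM raddf_sum -big_split; apply: eq_bigr => i _.
  by rewrite /= derivM !dE.
have := deriv_det (char_poly_mx N) dM.
move/(congr1 (fun p : {poly {poly D}} => p`_j)); rewrite dE => ->.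
rewrite (_ : map_mx d _ = - c N'); last first.
  apply/matrixP => a b; rewrite !mxE raddfB; apply/polyP => k.
  rewrite coefB !dE coefN coefMn coefX !coefC.
  by rewrite !derivMn -polyC1 derivC !mul0rn sub0r; case: ifP; rewrite ?raddf0.
rewrite mulmxN raddfN coefN; congr (- _).
rewrite adjE mulmx_suml raddf_sum coef_sum [RHS]big_mkcond /=.
apply: eq_bigr => k _; rewrite mulmx_suml raddf_sum coef_sum.
have termE i : (\tr (((char_poly N)`_k)%:P * 'X^(k.-1 - i) *: c N ^+ i *m c N'))`_j =
    (char_poly N)`_k * (if j == (k.-1 - i)%N then \tr (N ^+ i * N') else 0).
  rewrite -scalemxAl linearZ /= -rmorphXn /= -map_mxM trace_map_mx.
  rewrite -mulrA coefCM mulrC coefMC coefXn; case: eqP => _; rewrite ?mul1r ?mul0r ?mulr0 //.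
  exact: mulrC.
rewrite (eq_bigr (fun i : 'I_k => (char_poly N)`_k *
    (if j == (k.-1 - i)%N then \tr (N ^+ i * N') else 0))); last first.
  by move=> i _; rewrite -termE.
case: ifP => jk; last first.
  by rewrite big1 // => i _; case: eqP => [|_]; rewrite ?mulr0 //; have := ltn_ord i; lia.
have ik : (k - j.+1 < k)%N by lia.
rewrite (bigD1 (Ordinal ik)) //= ifT; last by lia.
rewrite big1 ?addr0 // => i ni; rewrite ifF ?mulr0 //.
by apply/negP => /eqP ji; case/negP: ni; apply/eqP/val_inj => /=; have := ltn_ord i; lia.
Qed.

(** A matrix need not commute with its derivative, but the trace restores the chain rule when the
    other factor commutes with G. *)
Lemma trace_horner_deriv (G Y : 'M[{poly D}]_r.+1) (W : {poly D}) :
  GRing.comm Y G ->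
  \tr (Y * map_mx (@deriv D) (horner_mx G (map_poly polyC W))) =
  \tr (Y * horner_mx G (map_poly polyC W^`()) * map_mx (@deriv D) G).
Proof.
have dM (A B : 'M[{poly D}]_r.+1) : map_mx (@deriv D) (A * B) =
    map_mx (@deriv D) A * B + A * map_mx (@deriv D) B.
  apply/matrixP => i j; rewrite !mxE raddf_sum -big_split; apply: eq_bigr => k _.
  by rewrite /= derivM !mxE.
elim/poly_ind: W Y => [|W c IH] Y cYG.
  by rewrite deriv0 !rmorph0 map_mx0 !mulr0 mul0r.
rewrite derivMXaddC !(rmorphD, rmorphM) /= map_polyC map_polyX horner_mx_X horner_mx_C.
rewrite map_mxD dM mulrDr mulrDr raddfD raddfD /=.
have -> : map_mx (@deriv D) (c%:P%:M) = 0 :> 'M_r.+1.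
  by apply/matrixP => i j; rewrite !mxE derivMn derivC mul0rn.
rewrite mulr0 raddf0 addr0 addrC !mulrDr mulrDl raddfD /= -mulrA; congr (_ + _).
have cYG' : GRing.comm (G * Y) G by rewrite /GRing.comm -mulrA cYG.
have trC (A B : 'M[{poly D}]_r.+1) : \tr (A * B) = \tr (B * A) by apply: mxtrace_mulC.
rewrite mulrA trC mulrA IH //; congr (\tr (_ * _)).
rewrite -cYG -!mulrA; congr (_ * _); rewrite -!mulmxE; apply/esym.
by apply: comm_horner_mx.
Qed.

(** * Slopes at least 1 from a trace identity *)

Section Slope.
Variables (G L : 'M[{poly D}]_r.+1) (W : {poly D}).
Let hW (V : {poly D}) := horner_mx G (map_poly polyC V).
Let N := hW W.
Let Z := hW W^`() * L.
Hypothesis cGL : GRing.comm G L.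
Hypothesis dG : forall Q : {poly {poly D}},
  \tr (horner_mx G Q * map_mx (@deriv D) G) = - \tr (horner_mx G Q * L).
Hypothesis nilN : exists d, Xn_dvdmx 1 (N ^+ d.+1).

Lemma char_poly_slope_deriv j :
  ((char_poly N)`_j)^`() =
  \sum_(k < r.+2 | (j < k)%N) (char_poly N)`_k * \tr (N ^+ (k - j.+1) * Z).
Proof.
rewrite char_poly_deriv -sumrN; apply: eq_bigr => k _; rewrite -mulrN; congr (_ * _).
rewrite trace_horner_deriv; last by apply/commr_sym/commrX; apply: comm_mx_horner.
have QE e : N ^+ e * hW W^`() = horner_mx G (map_poly polyC W ^+ e * map_poly polyC W^`()).
  by rewrite rmorphM rmorphXn.
by rewrite /Z mulrA !QE dG opprK.
Qed.

Lemma comm_N_Z : GRing.comm N Z.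
Proof.
apply: commrM; first exact: comm_horner_mx2.
by apply: comm_horner_mx.
Qed.

(** Nilpotency at 0 gives [N ^+ m] an order of about m / (d + 1). Substituting ['X^d.+1] for ['X]
    turns this into a power estimate with e = 1 and defect d. *)
Lemma char_poly_slope_pos j : (j <= r)%N -> ((char_poly N)`_j)`_0 = 0.
Proof.
have [d [B NB]] := nilN.
move=> jr; pose f := comp_poly 'X^(d.+1) : {poly D} -> {poly D}.
have [|g gE] := @char_poly_Xn_dvd d 1 (map_mx f N) _ j.
  move=> m; rewrite mul1n.
  have NE : N ^+ m = 'X^(m %/ d.+1) *: (B ^+ (m %/ d.+1) * N ^+ (m %% d.+1)).
    rewrite {1}(divn_eq m d.+1) exprD mulnC exprM NB.
    by rewrite exprZn expr1 -scalerAl.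
  rewrite -rmorphXn NE /= map_mxZ /f rmorphXn /= comp_polyX -exprM.
  rewrite scalerA -exprD; set k := (d + _)%N.
  apply: (@Xn_dvdmx_le _ _ k); last by eexists.
  by rewrite /k {1}(divn_eq m d.+1); have := ltn_pmod m (ltn0Sn d); lia.
move: gE; rewrite -map_char_poly coef_map /= => /(congr1 (fun p : {poly D} => p`_0)).
rewrite coef_comp_poly_Xn // dvdn0 div0n => ->; rewrite coefMXn mul1n ifT //; lia.
Qed.

(* If the smallest slope [ord (chi_j) / (r + 1 - j)] were [b / q] with [b < q], then the
   derivative formula would give [chi_j] an order larger than [b] at the index [j] which
   realizes it. *)
Lemma char_poly_slope j l : (l < r.+1 - j)%N -> ((char_poly N)`_j)`_l = 0.
Proof.
move=> lj; apply/eqP; apply/negPn/negP => chi_jl.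
have [a [b [Pab bq abmin]]] : exists (a : 'I_r.+1) b, [/\ ((char_poly N)`_a)`_b != 0,
    (b < r.+1 - a)%N & forall a' b', ((char_poly N)`_a')`_b' != 0 ->
      (b * (r.+1 - a') <= (r.+1 - a) * b')%N].
  have jr : (j < r.+1)%N by lia.
  pose S := (\max_(i < r.+1) size ((char_poly N)`_i)%R)%N.+1.
  have szS i k : ((char_poly N)`_i)`_k != 0 -> (i < r.+1)%N -> (k < S)%N.
    move=> ik ir; apply: leq_trans (leq_bigmax (F := fun i : 'I_r.+1 => size ((char_poly N)`_i)) (Ordinal ir)).
    by apply: ltnW; rewrite ltnNge; apply: contra ik => sk; rewrite nth_default.
  have lS := szS _ _ chi_jl jr.
  pose P (x : 'I_r.+1 * 'I_S) := ((char_poly N)`_x.1)`_x.2 != 0.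
  (* Multiplying by (r + 1)! clears the denominators r + 1 - j, so that slopes are compared, and
     minimized, as natural numbers. *)
  pose w (x : 'I_r.+1 * 'I_S) := (x.2 * (r.+1`! %/ (r.+1 - x.1)))%N.
  have wE (i : 'I_r.+1) : ((r.+1 - i) * (r.+1`! %/ (r.+1 - i)) = r.+1`!)%N.
    by rewrite mulnC divnK // dvdn_fact // ; have := ltn_ord i; lia.
  have P0 : P (Ordinal jr, Ordinal lS) by [].
  case: (arg_minnP w P0) => -[a b] Pab abmin; exists a, b.
  have abmin' (a' : 'I_r.+1) (b' : 'I_S) : P (a', b') -> (b * (r.+1 - a') <= (r.+1 - a) * b')%N.
    move=> /abmin; rewrite /w /= => ab.
    rewrite -(leq_pmul2l (fact_gt0 r.+1)).
    have /(leq_mul ab) := leqnn ((r.+1 - a) * (r.+1 - a'))%N.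
    rewrite [X in (X <= _)%N -> _](_ : _ = (r.+1)`! * (b * (r.+1 - a')))%N; last first.
      by rewrite -[in RHS](wE a); ring.
    rewrite [X in (_ <= X)%N -> _](_ : _ = (r.+1)`! * ((r.+1 - a) * b'))%N //.
    by rewrite -[in RHS](wE a'); ring.
  split=> //.
    have /= := abmin' (Ordinal jr) (Ordinal lS) P0; have := ltn_ord a; nia.
  move=> a' b' ab'; have [ar|ar] := ltnP a' r.+1; last by rewrite (_ : r.+1 - a' = 0)%N ?muln0 //; lia.
  exact: (abmin' (Ordinal ar) (Ordinal (szS _ _ ab' ar))).
have b0 : (0 < b)%N.
  case: b Pab {bq abmin} => // /eqP []; apply: char_poly_slope_pos; have := ltn_ord a; lia.
have : (((char_poly N)`_a)^`())`_b.-1 != 0.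
  rewrite coef_deriv prednK //; case: b b0 Pab {bq abmin} => // b _ Pab.
  by rewrite -mulr_natr mulf_neq0.
rewrite char_poly_slope_deriv coef_sum big1 ?eqxx // => k ak.
rewrite coefM big1 // => i _.
case: (eqVneq ((char_poly N)`_k)`_i 0) => [->|chi_ki]; first by rewrite mul0r.
have := abmin _ _ chi_ki => bk.
(* Put q = r + 1 - a. The two factors have orders at least b (r + 1 - k) / q and b (k - a - 1) / q,
   in total b - b / q, which exceeds b - 1 because b < q. *)
rewrite (@trace_coef0 (r.+1 - a) b) ?mulr0 //.
- by have := ltn_ord a; lia.
- exact: comm_N_Z.
- move=> j' i' ij; apply/eqP; apply/negPn/negP => /abmin; lia.
- have := ltn_ord a; have := ltn_ord k; have := ltn_ord i.
  move: bk bq ak; move: (nat_of_ord k) (nat_of_ord a) (nat_of_ord i) => k' a' i'; nia.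
Qed.

End Slope.

(** First-order Taylor expansion. The commutation clause makes the remainder an admissible
    perturbation for [char_poly_slope_add]. *)
Lemma horner_mx_shift (G L : 'M[{poly D}]_r.+1) (p : {poly {poly D}}) :
  GRing.comm G L -> exists Z, (forall Y, GRing.comm Y G -> GRing.comm Y L -> GRing.comm Y Z) /\
    horner_mx (G + 'X *: L) p = horner_mx G p + 'X *: Z.
Proof.
move=> cGL; elim/poly_ind: p => [|p c [Z [cZ pE]]].
  exists 0; split; first by move=> Y _ _; apply: commr0.
  by rewrite !rmorph0 scaler0 addr0.
exists (Z * G + horner_mx G p * L + 'X *: (Z * L)); split.
  move=> Y cYG cYL; have cYZ := cZ _ cYG cYL.
  apply: commrD; first by apply: commrD; apply: commrM => //; apply: comm_mx_horner.
  by rewrite /GRing.comm -scalerAl -scalerAr; congr (_ *: _); apply: commrM.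
rewrite !(rmorphD, rmorphM) /= !horner_mx_X !horner_mx_C pE mulrDl !mulrDr.
rewrite !scalerDr -!scalerAl -!scalerAr -!addrA; congr (_ + _).
by rewrite [RHS]addrC -!addrA [RHS]addrCA; congr (_ + (_ + _)); rewrite addrC.
Qed.

Lemma Xn_dvdmx1 (A : 'M[{poly D}]_r.+1) : (forall i j, (A i j)`_0 = 0) -> Xn_dvdmx 1 A.
Proof.
move=> A0; exists (\matrix_(i, j) drop_poly 1 (A i j)); apply/matrixP => i j.
rewrite !mxE mulrC -[LHS](poly_take_drop 1) (_ : take_poly 1 _ = 0) ?add0r //.
by apply/polyP => k; rewrite coef_take_poly coef0; case: k => //=; rewrite A0.
Qed.

(** Slopes at least 1 are equivalent, up to a constant defect, to the power estimate with e = 1, and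
    the binomial formula shows that this estimate is stable under a commuting multiple of ['X]. *)
Lemma char_poly_slope_add N Z :
  GRing.comm N Z ->
  (forall j l, (l < r.+1 - j)%N -> ((char_poly N)`_j)`_l = 0) ->
  (forall j l, (l < r.+1 - j)%N -> ((char_poly (N + 'X *: Z))`_j)`_l = 0).
Proof.
move=> cNZ H j l lj.
have H1 i : exists g, (char_poly N)`_i = g * 'X^(1 * (r.+1 - i)).
  by apply/Xn_factorP => i' ii; apply: H; rewrite mul1n in ii.
have := @char_poly_Xn_dvd (1 * r.+1) 1 (N + 'X *: Z) _ j.
have Hm m : Xn_dvdmx (1 * m) ('X^(1 * r.+1) *: (N + 'X *: Z) ^+ m).
  have cZ : GRing.comm N ('X *: Z) by rewrite /GRing.comm -scalerAr -scalerAl cNZ.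
  rewrite exprDn_comm // scaler_sumr; apply: Xn_dvdmx_sum => i _.
  rewrite -mulr_natr scalerAl; apply: Xn_dvdmxMr.
  rewrite scalerAl exprZn (_ : 1 * m = 1 * (m - i) + i)%N; last by have := ltn_ord i; lia.
  by apply: Xn_dvdmxM; [apply: powers_Xn_dvd | exists (Z ^+ i)].
by case=> [//|g ->]; rewrite coefMXn mul1n lj.
Qed.

End Order.

(** * Nilpotent endomorphisms *)

Section NilpotentRank.
Variables (K : fieldType) (m n : nat) (A : 'M[K]_m.+1).
Hypothesis n_gt0 : (0 < n)%N.
Hypothesis nilA : A ^+ n = 0.

Let d k := \rank (A ^+ k :&: kermx A)%MS.

Let rank_step k : (\rank (A ^+ k.+1) + d k = \rank (A ^+ k))%N.
Proof. by rewrite exprSr -mulmxE mxrank_mul_ker. Qed.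

Let d_mono k : (d k.+1 <= d k)%N.
Proof. by rewrite mxrankS // capmxS // exprS -mulmxE submxMl. Qed.

Let d_le k l : (k <= l)%N -> (d l <= d k)%N.
Proof.
move=> /subnK <-; elim: (l - k)%N => // i IH.
by rewrite addSn; apply: leq_trans (d_mono _) IH.
Qed.

Let d0 : d 0 = \rank (kermx A).
Proof. by rewrite /d expr0 cap1mx. Qed.

Let rank_sum k : (\rank (A ^+ k) + \sum_(i < k) d i = m.+1)%N.
Proof.
elim: k => [|k IH]; first by rewrite big_ord0 addn0 expr0 mxrank1.
rewrite big_ord_recr /= [(_ + d k)%N]addnC addnA rank_step; exact: IH.
Qed.

Let dim_sum : m.+1 = (\sum_(i < n) d i)%N.
Proof. by rewrite -(rank_sum n) nilA mxrank0. Qed.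

Lemma nilpotent_dim_le : (m.+1 <= n * \rank (kermx A))%N.
Proof.
rewrite [X in (X <= _)%N]dim_sum -d0 -[X in (_ <= X * _)%N]card_ord -sum_nat_const.
by apply: leq_sum => i _; apply: d_le.
Qed.

Lemma nilpotent_dim_eq :
  (m.+1 = n * \rank (kermx A))%N <-> (kermx A :=: A ^+ n.-1)%MS.
Proof.
have sub : (A ^+ n.-1 <= kermx A)%MS.
  by apply/sub_kermxP; rewrite mulmxE -exprSr prednK.
have dn : d n.-1 = \rank (A ^+ n.-1) by rewrite /d (capmx_idPl sub).
rewrite -d0; split=> [E|E].
  have dE : d n.-1 = d 0.
    apply/eqP; rewrite eqn_leq d_le //=; rewrite leqNgt; apply/negP => lt.
    suff : (\sum_(i < n) d i < n * d 0)%N by rewrite -dim_sum -E ltnn.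
    rewrite -[X in (X * _)%N]card_ord -sum_nat_const -(prednK n_gt0) !big_ord_recr /=.
    by rewrite -addnS leq_add // leq_sum // => i _; apply: d_le.
  apply/eqmx_sym/eqmxP.
  by rewrite -(mxrank_leqif_eq sub) -dn dE d0.
rewrite [LHS]dim_sum -[X in (X * _)%N]card_ord -sum_nat_const; apply: eq_bigr => i _.
have din : d n.-1 = d 0 by rewrite dn d0 E.
by apply/eqP; rewrite eqn_leq d_le //= -din d_le // -ltnS prednK.
Qed.
End NilpotentRank.

Module GradientIdeal.
From mathcomp Require Import generic_quotient ring_quotient boolp mpoly.

(** * Freeness over polynomials with dominant pure powers *)

Section DegLt.
Variables (R : comNzRingType) (n : nat).
Implicit Types p q : {mpoly R[n]}.

Definition deg_lt d p := forall m, (d <= mdeg m)%N -> p@_m = 0.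
Definition ord_ge d p := forall m, (mdeg m < d)%N -> p@_m = 0.

Lemma deg_lt0 d : deg_lt d 0.
Proof. by move=> m _; rewrite mcoeff0. Qed.

Lemma deg_ltD d p q : deg_lt d p -> deg_lt d q -> deg_lt d (p + q).
Proof. by move=> Hp Hq m dm; rewrite mcoeffD Hp ?Hq ?addr0. Qed.

Lemma deg_ltS d e p : (d <= e)%N -> deg_lt d p -> deg_lt e p.
Proof. by move=> de Hp m em; apply: Hp; apply: leq_trans em. Qed.

Lemma deg_ltM d e p q : deg_lt d.+1 p -> deg_lt e q -> deg_lt (d + e) (p * q).
Proof.
move=> Hp Hq m dm; rewrite mcoeffM big1 // => k /eqP mk.
have : (d < mdeg k.1)%N || (e <= mdeg k.2)%N.
  move: dm; have := congr1 (@mdeg n) mk; rewrite mdegD.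
  by move: (mdeg m) (mdeg k.1) (mdeg k.2) => u v w; lia.
by case/orP => [/Hp ->|/Hq ->]; rewrite ?mul0r ?mulr0.
Qed.

Lemma deg_ltX m : deg_lt (mdeg m).+1 'X_[m].
Proof. by move=> k mk; rewrite mcoeffX; case: eqP => // mE; rewrite mE ltnn in mk. Qed.

Lemma deg_lt_msize p : deg_lt (msize p) p.
Proof. by move=> m /msize_mdeg_ge /memN_msupp_eq0. Qed.

Lemma deg_lt_mderiv d p i : deg_lt d.+1 p -> deg_lt d p^`M(i).
Proof. by move=> Hp m dm; rewrite mcoeff_deriv Hp ?mul0rn // mdegD mdeg1 addn1. Qed.

Lemma ord_ge0 d : ord_ge d 0.
Proof. by move=> m _; rewrite mcoeff0. Qed.

Lemma ord_geD d p q : ord_ge d p -> ord_ge d q -> ord_ge d (p + q).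
Proof. by move=> Hp Hq m dm; rewrite mcoeffD Hp ?Hq ?addr0. Qed.

Lemma ord_geN d p : ord_ge d p -> ord_ge d (- p).
Proof. by move=> Hp m dm; rewrite mcoeffN Hp ?oppr0. Qed.

Lemma ord_ge_sum d (I : Type) (s : seq I) (P : pred I) (F : I -> {mpoly R[n]}) :
  (forall i, P i -> ord_ge d (F i)) -> ord_ge d (\sum_(i <- s | P i) F i).
Proof. by move=> H; elim/big_ind: _ => //; [apply: ord_ge0 | apply: ord_geD]. Qed.

Lemma ord_geM d e p q : ord_ge d p -> ord_ge e q -> ord_ge (d + e) (p * q).
Proof.
move=> Hp Hq m dm; rewrite mcoeffM big1 // => k /eqP mk.
have : (mdeg k.1 < d)%N || (mdeg k.2 < e)%N.
  move: dm; have := congr1 (@mdeg n) mk; rewrite mdegD.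
  by move: (mdeg m) (mdeg k.1) (mdeg k.2) => u v w; lia.
by case/orP => [/Hp ->|/Hq ->]; rewrite ?mul0r ?mulr0.
Qed.

Lemma ord_geS d e p : (d <= e)%N -> ord_ge e p -> ord_ge d p.
Proof. by move=> de Hp m em; apply: Hp; apply: leq_trans em de. Qed.

Definition top_monom m p := deg_lt (mdeg m) (p - 'X_[m]).

Lemma top_monomM m k p q : top_monom m p -> top_monom k q -> top_monom (m + k)%MM (p * q).
Proof.
rewrite /top_monom mpolyXD mdegD => Hp Hq.
have -> : p * q - 'X_[m] * 'X_[k] =
    'X_[m] * (q - 'X_[k]) + ((p - 'X_[m]) * (q - 'X_[k]) + 'X_[k] * (p - 'X_[m])) by ring.
apply: deg_ltD; first by apply: deg_ltM => //; apply: deg_ltX.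
apply: deg_ltD; first by apply: deg_ltM => //; apply: deg_ltS Hp.
by rewrite addnC; apply: deg_ltM => //; apply: deg_ltX.
Qed.

Lemma top_monomXn m p k : top_monom m p -> top_monom (m *+ k)%MM (p ^+ k).
Proof.
move=> Hp; elim: k => [|k IH]; first by rewrite /top_monom mulm0n expr0 mpolyX0 subrr; apply: deg_lt0.
by rewrite mulmS exprS; apply: top_monomM.
Qed.

End DegLt.

Definition box_mnm n M (t : {ffun 'I_n -> 'I_M}) : 'X_{1..n} := [multinom (t i : nat) | i < n].

Section FreeBasis.
Variables (R : comNzRingType) (n M : nat) (P : n.-tuple {mpoly R[n]}).
Hypothesis topP : forall i, top_monom (U_(i) *+ M.+1) (tnth P i).
Local Notation T := {ffun 'I_n -> 'I_M.+1}.
Local Notation basis t := ('X_[@box_mnm n M.+1 t] : {mpoly R[n]}).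

Definition spanned (h : {mpoly R[n]}) := exists c : {ffun T -> {mpoly R[n]}},
  h = \sum_t (c t \mPo P) * basis t.

Lemma spannedD p q : spanned p -> spanned q -> spanned (p + q).
Proof.
case=> c -> [d ->]; exists [ffun t => c t + d t]; rewrite -big_split.
by apply: eq_bigr => t _; rewrite ffunE comp_mpolyD mulrDl.
Qed.

Lemma spannedM (a p : {mpoly R[n]}) : spanned p -> spanned ((a \mPo P) * p).
Proof.
case=> c ->; exists [ffun t => a * c t]; rewrite mulr_sumr.
by apply: eq_bigr => t _; rewrite ffunE rmorphM mulrA.
Qed.

Lemma spanned0 : spanned 0.
Proof. by exists [ffun t => 0]; rewrite big1 // => t _; rewrite ffunE comp_mpoly0 mul0r. Qed.

Lemma spannedZ a p : spanned p -> spanned (a *: p).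
Proof. by move=> /(spannedM a%:MP); rewrite comp_mpolyC mul_mpolyC. Qed.

Lemma spanned_basis t : spanned (basis t).
Proof.
exists [ffun s => (s == t)%:R]; rewrite (bigD1 t) //= big1 ?addr0.
  by rewrite ffunE eqxx rmorph1 mul1r.
by move=> s /negPf st; rewrite ffunE st rmorph0 mul0r.
Qed.

(** Induction on the degree: a monomial with an exponent above M contains some x_i^(M+1), which is
    traded for P_i at the cost of terms of lower degree. *)
Lemma spanned_all h : spanned h.
Proof.
have gen d : forall h, deg_lt d h -> spanned h.
  elim: d => [|d IH] {}h Hh.
    by rewrite (_ : h = 0); [exact: spanned0 | apply/mpolyP => m; rewrite mcoeff0 Hh].
  rewrite (mpolyE h) big_seq; apply: big_ind; [exact: spanned0 | exact: spannedD |].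
  move=> m mh; apply: spannedZ.
  have md : (mdeg m <= d)%N.
    by rewrite leqNgt; apply/negP => /Hh /eqP; rewrite mcoeff_eq0 mh.
  case: (boolP [forall i, m i < M.+1])%N => [/forallP mM|].
    have -> : m = box_mnm [ffun i => Ordinal (mM i)].
      by apply/mnmP => i; rewrite mnmE ffunE.
    exact: spanned_basis.
  rewrite negb_forall => /existsP [i]; rewrite -leqNgt => Mi.
  have mE : m = (m - U_(i) *+ M.+1 + U_(i) *+ M.+1)%MM.
    rewrite submK //; apply/mnm_lepP => j; rewrite mulmnE mnm1E.
    by case: eqP => [<-|_]; rewrite ?mul1n // mul0n.
  set m' := (m - _)%MM in mE; have mm' : mdeg m = (mdeg m' + M.+1)%N.
    by rewrite mE mdegD mdegMn mdeg1 mul1n.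
  have -> : 'X_[m] = ('X_i \mPo P) * 'X_[m'] + - 1 *: ('X_[m'] * (tnth P i - 'X_[U_(i) *+ M.+1])).
    rewrite mE mpolyXD comp_mpolyXU -tnth_nth scaleN1r; ring.
  apply: spannedD.
    apply: spannedM; apply: IH; apply: deg_ltS (@deg_ltX _ _ m'); lia.
  apply: spannedZ; apply: IH; apply: (@deg_ltS _ _ (mdeg m' + M.+1)); first by lia.
  apply: deg_ltM; first exact: deg_ltX.
  by have := @topP i; rewrite /top_monom mdegMn mdeg1 mul1n.
exact: (gen _ _ (@deg_lt_msize _ _ h)).
Qed.

Lemma top_monom_comp m : top_monom (m *+ M.+1)%MM ('X_[m] \mPo P).
Proof.
rewrite comp_mpolyX.
have -> : (m *+ M.+1)%MM = \big[+%MM/0%MM]_i (U_(i) *+ M.+1 *+ m i)%MM.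
  apply/mnmP => j; rewrite mnm_sumE (bigD1 j) //= big1 => [|i /negPf ij].
    by rewrite !mulmnE mnm1E eqxx mul1n addn0 mulnC.
  by rewrite !mulmnE mnm1E ij.
apply: (big_ind2 (fun k p => top_monom k p)).
- by rewrite /top_monom mpolyX0 subrr; apply: deg_lt0.
- by move=> *; apply: top_monomM.
- by move=> i _; apply/top_monomXn/topP.
Qed.

(** The products P^b x^t have the top monomials x^((M+1) b + t), pairwise distinct by uniqueness of
    Euclidean division by M + 1. A relation is therefore undone from its highest degree
    downwards. *)
Lemma basis_free (c : {ffun T -> {mpoly R[n]}}) :
  \sum_t (c t \mPo P) * basis t = 0 -> forall t, c t = 0.
Proof.
move=> c0.
(* The total degree of the top monomial of P^b x^t. *)
pose wt (t : T) (b : 'X_{1..n}) := (mdeg (box_mnm t) + M.+1 * mdeg b)%N.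
pose B := (\max_t wt t (mlead (c t))).+1.
suff H k t b : (B - k <= wt t b)%N -> (c t)@_b = 0.
  by move=> t; apply/mpolyP => b; rewrite mcoeff0 (H B) // subnn.
elim: k t b => [|k IH] t0 b0.
  rewrite subn0 => Bt; apply/eqP; rewrite mcoeff_eq0; apply/negP => /msupp_le_mlead /lemc_mdeg bl.
  have : (wt t0 b0 < B)%N.
    rewrite ltnS; apply: leq_trans (leq_bigmax (F := fun t => wt t (mlead (c t))) t0).
    by rewrite leq_add2l leq_mul2l bl orbT.
  by rewrite ltnNge Bt.
move=> tb; have [/IH //|tbk] := leqP (B - k) (wt t0 b0).
have {}IH t b : (wt t0 b0 < wt t b)%N -> (c t)@_b = 0 by move=> tb'; apply: IH; lia.
set g := (box_mnm t0 + b0 *+ M.+1)%MM.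
have gE : mdeg g = wt t0 b0 by rewrite mdegD mdegMn mulnC.
have key t b : (c t)@_b * (('X_[b] \mPo P) * basis t)@_g = (c t)@_b * ((t == t0) && (b == b0))%:R.
  have [/IH ->|tb'] := ltnP (wt t0 b0) (wt t b); first by rewrite !mul0r.
  congr (_ * _).
  have top : top_monom (b *+ M.+1 + box_mnm t)%MM (('X_[b] \mPo P) * basis t).
    apply: top_monomM; first exact: top_monom_comp.
    by rewrite /top_monom subrr; apply: deg_lt0.
  have ge : (mdeg (b *+ M.+1 + box_mnm t)%MM <= mdeg g)%N.
    by rewrite gE mdegD mdegMn; rewrite /wt in tb' *; lia.
  have /eqP := top g ge; rewrite mcoeffB subr_eq0 => /eqP ->.
  rewrite mcoeffX; congr (_%:R); congr nat_of_bool.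
  apply/eqP/andP => [E|[/eqP -> /eqP ->]]; last by rewrite /g addmC.
  have tE i : t i = t0 i :> nat.
    have /(congr1 (fun k : 'X_{1..n} => k i %% M.+1)%N) := E.
    by rewrite !mnmDE !mulmnE !mnmE modnMDl addnC modnMDl !modn_small.
  split; last first.
    apply/eqP/mnmP => i; have /(congr1 (fun k : 'X_{1..n} => k i)) := E.
    by rewrite !mnmDE !mulmnE !mnmE tE addnC => /addnI /eqP; rewrite eqn_pmul2r // => /eqP.
  by apply/eqP/ffunP => i; apply/val_inj/tE.
move/(congr1 (mcoeff g)): c0; rewrite mcoeff0 raddf_sum /= => c0.
transitivity (\sum_t ((c t \mPo P) * basis t)@_g) => //.
transitivity (\sum_t \sum_(b <- msupp (c t)) (c t)@_b * ((t == t0) && (b == b0))%:R); last first.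
  apply: eq_bigr => t _; rewrite {1}(comp_mpolyEX (c t) P) mulr_suml raddf_sum.
  by apply: eq_bigr => b _; rewrite -scalerAl /= mcoeffZ key.
rewrite (bigD1 t0) //= eqxx [X in _ + X]big1 ?addr0; last first.
  by move=> t /negPf ->; rewrite big1 // => b _; rewrite mulr0.
rewrite {1}(mpolyE (c t0)) raddf_sum; apply: eq_bigr => b _.
by rewrite /= mcoeffZ mcoeffX.
Qed.
End FreeBasis.

(** * Multiplication matrices over the ring of the P_i *)

Section MultMatrix.
Variables (R : comNzRingType) (n r : nat) (P : n.-tuple {mpoly R[n]}).
Variable e : 'I_r.+1 -> {mpoly R[n]}.
Hypothesis e_span : forall h, exists c : {ffun 'I_r.+1 -> {mpoly R[n]}}, h == \sum_i (c i \mPo P) * e i.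
Hypothesis e_free : forall c : {ffun 'I_r.+1 -> {mpoly R[n]}},
  \sum_i (c i \mPo P) * e i = 0 -> forall i, c i = 0.

(** Row i holds the coordinates of [h * e i]. The entries are kept before substitution, as
    polynomials in new variables standing for the P_i. *)
Definition mult_mx h : 'M[{mpoly R[n]}]_r.+1 := \matrix_(i, j) xchoose (e_span (h * e i)) j.

Lemma mult_mxE h i : h * e i = \sum_j (mult_mx h i j \mPo P) * e j.
Proof.
rewrite {1}(eqP (xchooseP (e_span (h * e i)))).
by apply: eq_bigr => j _; rewrite mxE.
Qed.

Lemma mult_mx_uniq h (A : 'M_r.+1) :
  (forall i, h * e i = \sum_j (A i j \mPo P) * e j) -> mult_mx h = A.
Proof.
move=> H; apply/matrixP => i j; apply/eqP; rewrite -subr_eq0; apply/eqP.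
rewrite (_ : _ - _ = [ffun k => mult_mx h i k - A i k] j); last by rewrite ffunE.
apply: e_free; rewrite (eq_bigr (fun k => (mult_mx h i k \mPo P) * e k - (A i k \mPo P) * e k)).
  by rewrite sumrB -mult_mxE -H subrr.
by move=> k _; rewrite ffunE comp_mpolyB mulrBl.
Qed.

Lemma mult_mx_comp c : mult_mx (c \mPo P) = c%:M.
Proof.
apply: mult_mx_uniq => i; rewrite (bigD1 i) //= big1 ?addr0; first by rewrite mxE eqxx.
by move=> j /negPf ij; rewrite mxE eq_sym ij comp_mpoly0 mul0r.
Qed.

Fact mult_mx_is_additive : zmod_morphism mult_mx.
Proof.
move=> g h; apply: mult_mx_uniq => i; rewrite mulrBl !mult_mxE -sumrB.
by apply: eq_bigr => j _; rewrite !mxE comp_mpolyB mulrBl.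
Qed.

Fact mult_mx_is_multiplicative : monoid_morphism mult_mx.
Proof.
split; first by rewrite -(rmorph1 (comp_mpoly P)) mult_mx_comp.
move=> g h; apply: mult_mx_uniq => i; rewrite mulrAC mult_mxE mulr_suml.
rewrite (eq_bigr (fun j => \sum_k (mult_mx g i j * mult_mx h j k \mPo P) * e k)); last first.
  move=> j _; rewrite -mulrA [e j * h]mulrC mult_mxE mulr_sumr.
  by apply: eq_bigr => k _; rewrite rmorphM mulrA.
rewrite exchange_big /=; apply: eq_bigr => k _; rewrite -mulr_suml; congr (_ * _).
by rewrite !mxE raddf_sum.
Qed.

Lemma mult_mx_inj i0 h : e i0 = 1 -> mult_mx h = 0 -> h = 0.
Proof.
move=> e1 h0; rewrite -[h]mulr1 -e1 mult_mxE big1 // => j _.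
by rewrite h0 mxE comp_mpoly0 mul0r.
Qed.

End MultMatrix.

Section MultMorphism.
Variables (R : comNzRingType) (n M : nat) (P : n.-tuple {mpoly R[n]}).
Hypothesis topP : forall i, top_monom (U_(i) *+ M.+1) (tnth P i).

Lemma exists_free_basis : exists r (e : 'I_r.+1 -> {mpoly R[n]}),
  [/\ forall h, exists c : {ffun 'I_r.+1 -> {mpoly R[n]}}, h == \sum_i (c i \mPo P) * e i,
      forall c : {ffun 'I_r.+1 -> {mpoly R[n]}},
        \sum_i (c i \mPo P) * e i = 0 -> forall i, c i = 0
    & exists i, e i = 1].
Proof.
pose T := {ffun 'I_n -> 'I_M.+1}.
have [r rE] : exists r, #|T| = r.+1.
  by exists #|T|.-1; rewrite prednK // card_ffun card_ord expn_gt0.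
pose e (i : 'I_r.+1) : {mpoly R[n]} := 'X_[box_mnm (enum_val (cast_ord (esym rE) i))].
pose idx (t : T) := cast_ord rE (enum_rank t).
have idxK t : enum_val (cast_ord (esym rE) (idx t)) = t by rewrite cast_ordK enum_rankK.
have sumE (F : 'I_r.+1 -> {mpoly R[n]}) : \sum_i F i = \sum_t F (idx t).
  apply: (reindex idx); exists (fun i => enum_val (cast_ord (esym rE) i)) => [t _|i _].
    exact: idxK.
  by rewrite /idx enum_valK cast_ordKV.
have eE t : e (idx t) = 'X_[box_mnm t] by rewrite /e idxK.
exists r, e; split.
- move=> h; have [c ->] := spanned_all topP h.
  exists [ffun i => c (enum_val (cast_ord (esym rE) i))]; apply/eqP.
  by rewrite sumE; apply: eq_bigr => t _; rewrite ffunE idxK eE.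
- move=> c; rewrite sumE => c0 i.
  have := @basis_free _ _ _ _ topP [ffun t => c (idx t)] _ (enum_val (cast_ord (esym rE) i)).
  rewrite ffunE /idx enum_valK cast_ordKV; apply; rewrite -[RHS]c0.
  by apply: eq_bigr => t _; rewrite ffunE eE.
- exists (idx [ffun=> ord0]); rewrite eE (_ : box_mnm _ = 0%MM) ?mpolyX0 //.
  by apply/mnmP => i; rewrite mnmE ffunE mnm0E.
Qed.
Lemma exists_mult_morphism :
  exists r (mu : {rmorphism {mpoly R[n]} -> 'M[{mpoly R[n]}]_r.+1}),
    injective mu /\ forall c, mu (c \mPo P) = c%:M.
Proof.
have [r [e [e_span e_free [i0 e1]]]] := exists_free_basis.
pose muA := GRing.isZmodMorphism.Build _ _ _ (mult_mx_is_additive e_span e_free).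
pose muM := GRing.isMonoidMorphism.Build _ _ _ (mult_mx_is_multiplicative e_span e_free).
pose mu : {rmorphism {mpoly R[n]} -> 'M_r.+1} := HB.pack (mult_mx e_span) muA muM.
exists r, mu; split=> [|c]; last exact: mult_mx_comp.
by apply: raddf_inj => h; apply: mult_mx_inj e1.
Qed.
End MultMorphism.

(** * Integrality over the gradient ideal *)

Section Ray.
Variables (R : comNzRingType) (n : nat).
Local Notation D := {mpoly R[n]}.

(* Restriction to the generic line [y = t u] through the origin: the coefficients [D] carry the
   direction [u], the univariate variable is [t]. *)
Definition ray : {mpoly R[n]} -> {poly D} :=
  mmap (polyC \o @mpolyC n R) (fun i => 'X_i *: 'X).

HB.instance Definition _ := GRing.RMorphism.copy ray (mmap (polyC \o @mpolyC n R) (fun i => 'X_i *: 'X : {poly D})).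

Lemma rayC c : ray c%:MP = c%:MP%:P.
Proof. exact: mmapC. Qed.

Lemma rayX i : ray 'X_i = 'X_i *: 'X.
Proof. by rewrite /ray mmapX mmap1U. Qed.

Lemma ray_mnm m : ray 'X_[m] = 'X_[m] *: 'X^(mdeg m).
Proof.
rewrite /ray mmapX /mmap1 (eq_bigr (fun i => ('X_i ^+ m i)%:P * 'X^(m i))); last first.
  by move=> i _; rewrite exprZn -mul_polyC.
rewrite big_split /= -rmorph_prod /= -mpolyXE_id mul_polyC; congr (_ *: _).
by rewrite mdegE; elim/big_rec2: _ => [|i k p _ ->]; rewrite ?expr0 ?exprD.
Qed.

Lemma coef_ray p l m : ((ray p)`_l)@_m = p@_m *+ (mdeg m == l).
Proof.
rewrite {1}(mpolyE p) raddf_sum coef_sum raddf_sum /=.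
rewrite [in RHS](mpolyE p) raddf_sum /= -sumrMnl; apply: eq_bigr => k _.
rewrite -mul_mpolyC rmorphM /= rayC ray_mnm coefCM coefZ coefXn mulr_natr.
rewrite mulrnAr mcoeffMn !mcoeffCM mcoeffX.
by case: (eqVneq k m) => [->|_]; rewrite ?mulr0 ?mul0rn // eq_sym.
Qed.

(** The direction u is generic, so the coefficient of t^l is exactly the homogeneous part of degree
    l: no order is gained by restricting to the line. *)
Lemma ray_ord_ge p d : (forall l, (l < d)%N -> (ray p)`_l = 0) -> ord_ge d p.
Proof.
by move=> H m md; have /(congr1 (mcoeff m)) := H _ md; rewrite coef_ray eqxx mcoeff0.
Qed.

End Ray.

(** * The chain rule under the trace *)

Section TraceGradient.
Variables (R : comNzRingType) (n r : nat).
Variable D : comNzRingType.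
Variable nu : {rmorphism {mpoly R[n]} -> 'M[{poly D}]_r.+1}.
Hypothesis nuC : forall c, map_mx (@deriv D) (nu c%:MP) = 0.
Local Notation d := (map_mx (@deriv D)).

Lemma map_deriv_mulmx (A B : 'M[{poly D}]_r.+1) : d (A * B) = d A * B + A * d B.
Proof.
apply/matrixP => i j; rewrite !mxE raddf_sum -big_split; apply: eq_bigr => k _.
by rewrite /= derivM !mxE.
Qed.

Let trC (A B : 'M[{poly D}]_r.+1) : \tr (A * B) = \tr (B * A).
Proof. exact: mxtrace_mulC. Qed.

(** The derivative of a matrix [nu g] need not commute with the image of [nu], but cyclicity of the
    trace moves it to the end. Hence h -> tr (Y d (nu h)) satisfies the Leibniz rule and is
    determined by its values at the variables. *)
Lemma trace_grad Y h : (forall g, GRing.comm Y (nu g)) ->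
  \tr (Y * d (nu h)) = \sum_j \tr (Y * nu h^`M(j) * d (nu 'X_j)).
Proof.
pose S h := forall Y, (forall g, GRing.comm Y (nu g)) ->
  \tr (Y * d (nu h)) = \sum_j \tr (Y * nu h^`M(j) * d (nu 'X_j)).
have SM p q : S p -> S q -> S (p * q).
  move=> Sp Sq Z cZ.
  have cZM g g' : GRing.comm (Z * nu g) (nu g').
    rewrite /GRing.comm -mulrA -rmorphM [g * _]mulrC rmorphM.
    by rewrite mulrA cZ mulrA.
  rewrite rmorphM map_deriv_mulmx mulrDr raddfD /=.
  rewrite mulrA [in X in _ + X]mulrA trC mulrA -cZ Sp // [X in _ + X]Sq // -big_split.
  apply: eq_bigr => j _; rewrite /= mderivM rmorphD !rmorphM mulrDr mulrDl raddfD /=.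
  by rewrite -[nu p^`M(j) * _]rmorphM [_ * q]mulrC rmorphM -!mulrA.
have SD p q : S p -> S q -> S (p + q).
  move=> Sp Sq Z cZ; rewrite rmorphD map_mxD mulrDr raddfD /= Sp // Sq // -big_split.
  by apply: eq_bigr => j _; rewrite /= raddfD rmorphD mulrDr mulrDl raddfD.
have SC c : S c%:MP.
  move=> Z _; rewrite nuC mulr0 raddf0 big1 // => j _.
  by rewrite mderivC rmorph0 mulr0 mul0r raddf0.
have SX i : S 'X_i.
  move=> Z _; rewrite (bigD1 i) //= big1 ?addr0 => [|j /negPf ij].
    by rewrite mderivX mnm1E eqxx scale1r (_ : _ - _ = 0)%MM ?mpolyX0 ?rmorph1 ?mulr1 //; apply/mnmP => k; rewrite mnmBE subnn mnm0E.
  by rewrite mderivX mnm1E eq_sym ij scale0r rmorph0 mulr0 mul0r raddf0.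
have S1 : S 1 by rewrite -mpolyC1.
have Sm m : S 'X_[m].
  rewrite mpolyXE_id; elim/big_ind: _ => // i _.
  by elim: (m i) => [|k IH]; rewrite ?expr0 // exprS; apply: SM.
suff : S h by apply.
by elim/mpolyind: h => [|c m p _ _ Sp]; [rewrite -mpolyC0 | apply: SD => //; rewrite -mul_mpolyC; apply: SM].
Qed.
End TraceGradient.

Section Integrality.
Variables (K : fieldType) (n M : nat).
Hypothesis char0 : forall k, k.+1%:R != 0 :> K.
Variables (F : {mpoly K[n]}).
Let P := [tuple F^`M(i) | i < n].
Hypothesis topP : forall i, top_monom (U_(i) *+ M.+1) F^`M(i).
Local Notation D := {mpoly K[n]}.

Lemma mpoly_char0 k : k.+1%:R != 0 :> D.
Proof.
apply/eqP => /(congr1 (mcoeff 0%MM)).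
by rewrite -mpolyC_nat mcoeffC eqxx mulr1 mcoeff0 => /eqP; rewrite (negPf (char0 k)).
Qed.

(* The unit factor [V.[F]] removes the critical values other than [0]. *)
Lemma integral_over_gradient : exists (V : {poly K}) (s : nat) (a : nat -> {mpoly K[n]}),
  let w := F * (map_poly (@mpolyC n K) V).[F] in
  [/\ V`_0 != 0,
      forall j, ord_ge (s - j) (a j)
    & w ^+ s = \sum_(j < s) (a j \mPo P) * w ^+ j].
Proof.
have topP' i : top_monom (U_(i) *+ M.+1) (tnth P i) by rewrite tnth_mktuple.
have [r [mu [mu_inj muP]]] := exists_mult_morphism topP'.
have muPi i : mu F^`M(i) = ('X_i)%:M.
  by rewrite -muP comp_mpolyXU -tnth_nth tnth_mktuple.
have muC c : mu c%:MP = (c%:MP)%:M by rewrite -muP comp_mpolyC.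
have [nu nuE] : exists nu : {rmorphism {mpoly K[n]} -> 'M[{poly D}]_r.+1},
    forall g, nu g = map_mx (@ray K n) (mu g).
  by exists (map_mx (@ray K n) \o mu).
have nuC c : nu c%:MP = (c%:MP%:P)%:M by rewrite nuE muC map_scalar_mx /= rayC.
have nuPi i : nu F^`M(i) = ('X_i *: 'X)%:M by rewrite nuE muPi map_scalar_mx /= rayX.
have dscal (c : D) : map_mx (@deriv D) (c%:P%:M) = 0 :> 'M_r.+1.
  by apply/matrixP => i j; rewrite !mxE derivMn derivC mul0rn.
have dnuC c : map_mx (@deriv D) (nu c%:MP) = 0 by rewrite nuC dscal.
have mulr_scalar_mx (p : {poly D}) (A : 'M_r.+1) : A * p%:M = p *: A.
  by rewrite -mulmxE scalar_mxC mul_scalar_mx.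
have cnu g h : GRing.comm (nu g) (nu h) by rewrite /GRing.comm -!rmorphM mulrC.
pose L := \sum_j ('X_j)%:P *: nu 'X_j.
(* Since [nu] sends the j-th partial derivative to u_j t, the trace of [Y * d (nu F)] is that of t
   sum_j u_j Y d (nu x_j). Subtracting ['X *: L] cancels it and leaves only - L. *)
pose G := nu F - 'X *: L.
have cL g : GRing.comm L (nu g).
  apply/commr_sym/commr_sum => j _; rewrite /GRing.comm -scalerAr -scalerAl; congr (_ *: _).
  exact: cnu.
have cGnu g : GRing.comm G (nu g).
  apply/commr_sym/commrB; first exact: cnu.
  by rewrite /GRing.comm -scalerAr -scalerAl cL.
have cGL : GRing.comm G L.
  apply/commr_sym/commrB; first exact: cL.
  by rewrite /GRing.comm -scalerAr -scalerAl.
have dG (Q : {poly {poly D}}) :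
    \tr (horner_mx G Q * map_mx (@deriv D) G) = - \tr (horner_mx G Q * L).
  set Y := horner_mx G Q.
  have cY g : GRing.comm Y (nu g) by apply/commr_sym/comm_mx_horner/commr_sym/cGnu.
  have dL : map_mx (@deriv D) L = \sum_j ('X_j)%:P *: map_mx (@deriv D) (nu 'X_j).
    rewrite raddf_sum; apply: eq_bigr => j _; apply/matrixP => a b.
    by rewrite /= !mxE derivM derivC mul0r add0r.
  have dXL : map_mx (@deriv D) ('X *: L) = L + 'X *: map_mx (@deriv D) L.
    by apply/matrixP => i j; rewrite !mxE derivM derivX mul1r.
  rewrite map_mxB dXL mulrBr raddfB /= (trace_grad dnuC) // mulrDr raddfD /=.
  rewrite opprD addrCA -[RHS]addr0; congr (_ + _); apply/eqP; rewrite subr_eq0; apply/eqP.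
  rewrite dL -scalerAr mulr_sumr scaler_sumr raddf_sum /=.
  apply: eq_bigr => j _; rewrite nuPi -scalerAr scalerA.
  by rewrite mulr_scalar_mx -scalerAl -mul_polyC ['X * _]mulrC.
(* [A0] is the multiplication by F on the fibre P = 0, so its eigenvalues are critical values. [Q]
   gathers the nonzero ones with multiplicity; then [W0 ^+ d0.+1] is a multiple of the
   characteristic polynomial of [A0], which gives nilpotency at t = 0. *)
pose A0 := map_mx (mcoeff 0%MM) (mu F).
have [d0 [Q]] := multiplicity_XsubC (char_poly A0) 0.
rewrite monic_neq0 ?char_poly_monic //= subr0 => Q0 chiE.
pose W0 := 'X * Q; pose W := map_poly (@mpolyC n K) W0.
have G0 : map_mx (horner_eval 0) G = map_mx (@mpolyC n K) A0.
  apply/matrixP => i j; rewrite !mxE nuE !mxE /= /horner_eval hornerD hornerN hornerM hornerX mul0r subr0.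
  rewrite horner_coef0; apply/mpolyP => m; rewrite coef_ray mcoeffC mdeg_eq0.
  by case: eqP => [->|_]; rewrite ?mulr1 ?mulr0.
have nil : exists d, Xn_dvdmx 1 (horner_mx G (map_poly polyC W) ^+ d.+1).
  exists d0; apply: Xn_dvdmx1 => i j.
  have : map_mx (horner_eval 0) (horner_mx G (map_poly polyC W) ^+ d0.+1) = 0.
    rewrite rmorphXn /= map_horner_mx G0 -map_poly_comp.
    rewrite (eq_map_poly (g := id)) ?map_poly_id // => [|c]; last by rewrite /= /horner_eval hornerC.
    rewrite -map_horner_mx -rmorphXn -rmorphXn /=.
    rewrite (_ : W0 ^+ d0.+1 = char_poly A0 * ('X * Q ^+ d0)); last first.
      by rewrite chiE exprMn !exprS; ring.
    by rewrite rmorphM /= Cayley_Hamilton mul0r raddf0.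
  move/matrixP/(_ i j); rewrite !mxE /horner_eval horner_coef0; exact.
have slope := char_poly_slope mpoly_char0 cGL dG nil.
have [Z [cZ hE]] := horner_mx_shift (map_poly polyC W) cGL.
pose w := F * (map_poly (@mpolyC n K) Q).[F].
(* [w] is W0 at F, whereas the slope estimate concerns W0 at G; the two arguments differ by
   ['X *: L]. *)
have wE : nu w = horner_mx G (map_poly polyC W) + 'X *: Z.
  rewrite -hE subrK (_ : w = (map_poly (@mpolyC n K) W0).[F]); last first.
    by rewrite rmorphM /= map_polyX hornerM hornerX.
  rewrite -horner_map /= /horner_mx /horner_morph -!map_poly_comp; congr (_.[_]).
  by apply: eq_map_poly => c; rewrite /= nuC.
have slope' : forall j l, (l < r.+1 - j)%N -> ((char_poly (nu w))`_j)`_l = 0.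
  rewrite wE; apply: (char_poly_slope_add mpoly_char0) slope.
  apply: cZ; first by apply/commr_sym/comm_mx_horner.
  by apply: comm_horner_mx.
exists Q, r.+1, (fun j => - (char_poly (mu w))`_j); split.
- by move: Q0; rewrite rootE horner_coef0.
- move=> j; apply/ord_geN/ray_ord_ge => l /slope'.
  by rewrite nuE -map_char_poly coef_map.
- rewrite -/w; apply: mu_inj; rewrite rmorphXn raddf_sum /=.
  have := Cayley_Hamilton (mu w); rewrite /horner_mx /horner_morph.
  rewrite (horner_coef_wide _ (n := r.+2)); last first.
    by rewrite -(size_char_poly (mu w)) size_poly.
  rewrite big_ord_recr /= coef_map /= (_ : (char_poly (mu w))`_r.+1 = 1); last first.
    by have := char_poly_monic (mu w); rewrite monicE lead_coefE size_char_poly => /eqP.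
  rewrite mul1r addrC => /eqP; rewrite addr_eq0 => /eqP ->; rewrite -sumrN.
  apply: eq_bigr => j _; rewrite coef_map /= comp_mpolyN mulNr [RHS]raddfN; congr (- _).
  by rewrite [RHS]rmorphM [mu (w ^+ j)]rmorphXn /= muP.
Qed.
End Integrality.

(** * Reduction modulo a prime *)

Local Open Scope quotient_scope.

(* Inverting one nonzero element of the image of [ev] inverts only finitely many primes. *)
Definition few_units (A : comNzRingType) (K : fieldType) (ev : A -> K) :=
  forall b, ev b != 0 -> exists P, forall p, prime p -> (P < p)%N ->
    forall a k, p%:R * ev a <> ev b ^+ k.

Lemma few_units_int (K : fieldType) : (forall k, k.+1%:R != 0 :> K) ->
  few_units (fun z : int => z%:~R : K).
Proof.
move=> char0 b b0; exists `|b|%N => p pp bp a k.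
have inj (z : int) : z%:~R = 0 :> K -> z = 0.
  case: z => [[|m]|m] //.
    by rewrite -pmulrn => /eqP; rewrite (negPf (char0 m)).
  by rewrite NegzE mulrNz => /eqP; rewrite oppr_eq0 -pmulrn (negPf (char0 m)).
have -> : p%:R = p%:Z%:~R :> K by [].
move=> /eqP; rewrite -subr_eq0 -rmorphM -rmorphXn -rmorphB => /eqP /inj /eqP.
rewrite subr_eq0 => /eqP /(congr1 absz); rewrite abszM abszX absz_nat => E.
have : (p %| `|b| ^ k)%N by rewrite -E dvdn_mulr.
case: k E => [|k] E; first by rewrite dvdn1 => /eqP p1; rewrite p1 in pp.
rewrite Euclid_dvdX // => /andP [/dvdn_leq pb _].
have : (0 < `|b|)%N by rewrite absz_gt0; apply: contraNneq b0 => ->; rewrite mulr0z.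
by move/pb; rewrite leqNgt bp.
Qed.

(** * Adjoining one element to the ring of coefficients *)

Section Adjoin.
Variables (A : comNzRingType) (K : fieldType) (ev : {rmorphism A -> K}) (x : K).
Hypothesis ev_few : few_units ev.

(** The subring generated by ev(A) and x is represented by [{poly A}] with an evaluation into K,
    which need not be injective; equalities are tested after evaluation. *)
Definition adjoin (p : {poly A}) : K := (map_poly ev p).[x].

HB.instance Definition _ := GRing.RMorphism.copy adjoin (horner_eval x \o map_poly ev).

Lemma adjoinC a : adjoin a%:P = ev a.
Proof. by rewrite /adjoin map_polyC hornerC. Qed.

Lemma adjoinX : adjoin 'X = x.
Proof. by rewrite /adjoin map_polyX hornerX. Qed.

(** An equation p a = b^k between values at x is then an identity of polynomials, and its
    coefficient of degree d k is an equation of the same kind for the leading coefficient of b. *)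
Lemma few_units_transcendental :
  (forall g, adjoin g = 0 -> map_poly ev g = 0) -> few_units adjoin.
Proof.
move=> inj b b0.
have b0' : map_poly ev b != 0 by apply: contraNneq b0; rewrite /adjoin => ->; rewrite horner0.
pose d := (size (map_poly ev b)).-1.
have [|P HP] := ev_few (b := b`_d).
  by rewrite -coef_map -lead_coefE lead_coef_eq0.
exists P => p pp Pp a k E.
have /inj /eqP : adjoin (p%:R * a - b ^+ k) = 0.
  by rewrite rmorphB /= rmorphM rmorphXn /= rmorph_nat E subrr.
rewrite rmorphB /= rmorphM rmorphXn /= rmorph_nat subr_eq0 => /eqP /(congr1 (fun q : {poly K} => q`_(d * k))).
have -> : (map_poly ev b ^+ k)`_(d * k) = ev b`_d ^+ k.
  rewrite -coef_map -lead_coefE -lead_coef_exp lead_coefE size_exp; congr (_`_ _).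
rewrite -polyC_natr coefCM coef_map; exact: HP.
Qed.

Section Algebraic.
Variable g : {poly A}.
Hypothesis g_root : adjoin g = 0.
Hypothesis g_lead : ev (lead_coef g) != 0.
Hypothesis g_min : forall h, adjoin h = 0 -> (size h < size g)%N -> map_poly ev h = 0.
Local Notation gam := (lead_coef g).

Lemma adjoin_size : (1 < size g)%N.
Proof.
rewrite ltnNge; apply/negP => /size1_polyC gE.
move: g_root g_lead; rewrite {1}gE adjoinC lead_coefE => g0.
by rewrite gE size_polyC; case: (g`_0 == 0); rewrite coefC /= g0 eqxx.
Qed.

Lemma adjoin_pseudo_div h : exists E (r : {poly A}), (size r < size g)%N /\ ev gam ^+ E * adjoin h = adjoin r.
Proof.
have [m] := ubnP (size h); elim: m h => // m IH h; rewrite ltnS => hm.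
have [sh|sh] := ltnP (size h) (size g); first by exists 0, h; rewrite expr0 mul1r.
pose h' := gam%:P * h - (lead_coef h)%:P * 'X^(size h - size g) * g.
have g1 := adjoin_size.
have [|E [r [rg rE]]] := IH h'.
  apply: leq_trans (_ : (size h).-1.+1 <= _)%N; last by lia.
  rewrite ltnS; apply/leq_sizeP => j jh; rewrite coefB coefCM -mulrA coefCM coefXnM.
  case: (ltnP j (size h)) => jh'.
    have -> : j = (size h).-1 by lia.
    rewrite ifF; last by lia.
    rewrite (_ : (size h).-1 - (size h - size g) = (size g).-1)%N; last by lia.
    by rewrite -!lead_coefE mulrC subrr.
  rewrite (nth_default _ jh') mulr0 sub0r; case: ifP => _; rewrite ?mulr0 ?oppr0 //.
  rewrite nth_default ?mulr0 ?oppr0 //.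
  by have := leq_sub2r (size h - size g) jh'; rewrite subKn.
exists E.+1, r; split=> //; rewrite -rE /h' rmorphB /= !rmorphM /= g_root mulr0 subr0 adjoinC.
by rewrite exprSr mulrA.
Qed.

Lemma adjoin_integral : integralOver ev (ev gam * x).
Proof.
have g1 := adjoin_size; pose d := (size g).-1.
pose q' := \poly_(i < d) (g`_i * gam ^+ (d.-1 - i)); pose q := 'X^d + q'.
exists q.
  have sq : (size q' < size ('X^d : {poly A}))%N.
    by rewrite size_polyXn ltnS size_poly.
  by rewrite monicE lead_coefDl // lead_coefXn.
rewrite rootE; have : adjoin g * ev gam ^+ d.-1 = 0 by rewrite g_root mul0r.
rewrite /adjoin (horner_coef_wide _ (n := d.+1)); last first.
  by rewrite (leq_trans (size_poly _ _)) // /d; lia.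
rewrite big_ord_recr /= mulrDl addrC => E.
rewrite /q rmorphD /= hornerD map_polyXn hornerXn.
apply/eqP; rewrite -[RHS]E; congr (_ + _).
  rewrite coef_map /= -/d -lead_coefE exprMn -{1}(prednK (_ : 0 < d)%N) ?exprS; [ring|lia].
rewrite (horner_coef_wide _ (n := d)); last by rewrite (leq_trans (size_poly _ _)) // size_poly.
rewrite mulr_suml; apply: eq_bigr => i _; rewrite !coef_map coef_poly ltn_ord /=.
rewrite rmorphM rmorphXn exprMn -{2}(subnK (_ : i <= d.-1)%N); last by have := ltn_ord i; lia.
rewrite exprD; ring.
Qed.

Lemma adjoin_multiple_integral b : exists E, integralOver ev (ev gam ^+ E * adjoin b).
Proof.
exists (size b).
have -> : ev gam ^+ size b * adjoin b =
    (\poly_(i < size b) ev (b`_i * gam ^+ (size b - i))).[ev gam * x].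
  rewrite /adjoin (horner_coef_wide _ (n := size b)) ?size_poly //.
  rewrite [RHS](horner_coef_wide _ (n := size b)) ?size_poly //.
  rewrite mulr_sumr; apply: eq_bigr => i _; rewrite coef_poly ltn_ord coef_map /=.
  rewrite rmorphM rmorphXn exprMn -{1}(subnK (ltnW (ltn_ord i))) exprD; ring.
apply: integral_horner adjoin_integral; apply/integral_poly => i.
by rewrite coef_poly; case: ifP => _; [apply: integral_id | apply: integral0].
Qed.

(** Once the powers of u are divided out of its equation, the constant term is nonzero and is itself
    a multiple of u. *)
Lemma nonzero_multiple u w (h : {poly A}) :
  u = adjoin w -> u != 0 -> map_poly ev h != 0 -> (map_poly ev h).[u] = 0 ->
  exists beta v, ev beta != 0 /\ ev beta = u * adjoin v.
Proof.
move=> uw u0; elim/poly_ind: h => [|h c IH]; first by rewrite rmorph0 eqxx.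
rewrite rmorphD rmorphM /= map_polyX map_polyC /= => hn0; rewrite hornerMXaddC => hu.
have [c0|c0] := eqVneq (ev c) 0.
  apply: IH; first by apply: contraNneq hn0 => ->; rewrite mul0r add0r c0.
  by move/eqP: hu; rewrite c0 addr0 mulf_eq0 (negPf u0) orbF => /eqP.
exists c, (- (map_poly polyC h).[w]); split=> //.
have -> : adjoin (- (map_poly polyC h).[w]) = - (map_poly ev h).[u].
  rewrite raddfN /=; congr (- _); rewrite -horner_map /= -uw -map_poly_comp.
  by congr (_.[_]); apply: eq_map_poly => a; rewrite /= adjoinC.
by rewrite mulrN mulrC; apply/eqP; rewrite -addr_eq0 addrC hu.
Qed.

(** Some nonzero [beta] of the base is a multiple of b, up to a power of [gam]. An equation p a =
    b^k thus yields p a' = beta^k; pseudo-division by [g] makes a' of small degree, minimality of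
    [g] turns the equation into an identity of polynomials, and its constant coefficient contradicts
    the property of the base at [gam * beta]. *)
Lemma few_units_algebraic : few_units adjoin.
Proof.
move=> b b0; have [E [h hm hr]] := adjoin_multiple_integral b.
have u0 : ev gam ^+ E * adjoin b != 0 by rewrite mulf_neq0 ?expf_neq0.
have uw : ev gam ^+ E * adjoin b = adjoin ((gam ^+ E)%:P * b).
  by rewrite rmorphM /= adjoinC rmorphXn.
have [||beta [v [beta0 betaE]]] := nonzero_multiple (h := h) uw u0.
- by rewrite monic_neq0 // monic_map.
- exact/eqP.
have [|P HP] := ev_few (b := gam * beta); first by rewrite rmorphM mulf_neq0.
exists P => p pp Pp a k pa.
have [E' [r [rg rE]]] := adjoin_pseudo_div (a * ((gam ^+ E)%:P * v) ^+ k).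
have pr : p%:R * adjoin r = ev (gam ^+ E' * beta ^+ k).
  have aE : p%:R * adjoin (a * ((gam ^+ E)%:P * v) ^+ k) = ev beta ^+ k.
    rewrite rmorphM rmorphXn rmorphM /= adjoinC rmorphXn mulrA pa -exprMn betaE.
    by congr (_ ^+ _); ring.
  by rewrite -rE mulrCA aE rmorphM !rmorphXn.
have /g_min : adjoin (p%:R * r - (gam ^+ E' * beta ^+ k)%:P) = 0.
  by rewrite rmorphB /= rmorphM rmorph_nat /= adjoinC pr subrr.
have g1 := adjoin_size.
have sr : (size (p%:R * r - (gam ^+ E' * beta ^+ k)%:P)%R < size g)%N.
  rewrite (leq_ltn_trans (size_polyD _ _)) // size_polyN gtn_max; apply/andP; split.
    by rewrite -polyC_natr mul_polyC (leq_ltn_trans (size_scale_leq _ _)).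
  by rewrite (leq_ltn_trans (size_polyC_leq1 _)).
move/(_ sr)/(congr1 (fun q : {poly K} => q`_0)).
rewrite coef_map coef0 coefB -polyC_natr coefCM coefC /= rmorphB /= rmorphM rmorph_nat => /eqP.
rewrite subr_eq0 => /eqP pr0.
apply: (HP p pp Pp (r`_0 * (gam ^+ k * beta ^+ E')) (E' + k)%N).
rewrite rmorphM mulrA pr0 -rmorphM -rmorphXn; congr (ev _).
rewrite exprMn !exprD; ring.
Qed.
End Algebraic.

(** In the algebraic case [g] has least size among the annihilators of x whose leading coefficient
    survives in K. [trim] discards the leading coefficients killed by [ev], so that this minimality
    applies to every annihilator. *)
Lemma few_units_adjoin : few_units adjoin.
Proof.
pose ann m := `[< exists g : {poly A}, [/\ size g = m, adjoin g = 0 & ev (lead_coef g) != 0] >].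
have trim g : adjoin g = 0 -> map_poly ev g != 0 ->
    exists m, (m <= size g)%N /\ ann m.
  move=> g0 gn0; pose m := size (map_poly ev g).
  pose g' := take_poly m g.
  have mapE : map_poly ev g' = map_poly ev g.
    apply/polyP => i; rewrite !coef_map coef_take_poly; case: ltnP => // mi.
    by rewrite raddf0 -coef_map nth_default.
  have m0 : (0 < m)%N by rewrite size_poly_gt0.
  have top : ev g'`_m.-1 != 0.
    by rewrite -coef_map mapE /m -lead_coefE lead_coef_eq0.
  have sg' : size g' = m.
    apply/eqP; rewrite eqn_leq size_take_poly /=.
    rewrite leqNgt; apply/negP => sm; move: top; rewrite nth_default ?raddf0 ?eqxx //.
    by rewrite -ltnS prednK.
  exists m; split; first by rewrite /m size_poly.
  by apply/asboolP; exists g'; rewrite /adjoin mapE lead_coefE sg'; split.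
have [[m0 annm0]|H] := pselect (exists m, ann m); last first.
  apply: few_units_transcendental => g g0; apply/eqP/negPn/negP => gn0.
  by have [m [_ annm]] := trim g g0 gn0; apply: H; exists m.
case: (ex_minnP (ex_intro _ m0 annm0)) => m /asboolP [g [gm g0 gl]] m_min.
apply: (few_units_algebraic g0 gl) => h h0 hg; apply/eqP/negPn/negP => hn0.
by have [m' [m'h /m_min]] := trim h h0 hn0; lia.
Qed.
End Adjoin.

Lemma finite_type_subring (K : fieldType) (s : seq K) : (forall k, k.+1%:R != 0 :> K) ->
  exists (A : comNzRingType) (ev : {rmorphism A -> K}),
    few_units ev /\ forall c, c \in s -> exists a, ev a = c.
Proof.
move=> char0; elim: s => [|x s [A [ev [few sP]]]].
  by exists int, intr; split=> //; apply: few_units_int.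
exists {poly A}, (adjoin ev x); split; first exact: few_units_adjoin.
move=> c; rewrite inE => /predU1P [->|/sP [a <-]].
  by exists 'X; apply: adjoinX.
by exists a%:P; apply: adjoinC.
Qed.

(** * The quotient by a large prime *)

Section ModP.
Variables (A : comNzRingType) (K : fieldType) (ev : {rmorphism A -> K}) (p : nat).
Hypothesis p_nonunit : forall a, p%:R * ev a <> 1.

(** Defined through [ev], the ideal contains the kernel of [ev], and the quotient is ev(A) / p
    ev(A). *)
Definition mod_p_ideal (a : A) : bool := `[< exists b, ev a = p%:R * ev b >].

Lemma mod_p_ideal_closed : idealr_closed mod_p_ideal.
Proof.
split.
- by apply/asboolP; exists 0; rewrite !rmorph0 mulr0.
- by apply/asboolP => -[b]; rewrite rmorph1 => /esym /p_nonunit.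
- move=> a u v /asboolP [b ub] /asboolP [c vc]; apply/asboolP; exists (a * b + c).
  by rewrite !(rmorphD, rmorphM) /= ub vc; ring.
Qed.
End ModP.

(** The target is a nonzero ring of characteristic p, in which a chosen scalar stays invertible when
    its inverse is listed in [s]. The clause on kernels carries every relation that holds in K over
    to [k]. *)
Lemma reduction_mod_p (K : fieldType) (s : seq K) (B : nat) : (forall k, k.+1%:R != 0 :> K) ->
  exists (A k : comNzRingType) (ev : {rmorphism A -> K}) (q : {rmorphism A -> k}) (p : nat),
    [/\ p \in [pchar k], (B < p)%N,
        forall a, ev a = 0 -> q a = 0 & forall c, c \in s -> exists a, ev a = c].
Proof.
move=> char0; have [A [ev [few sP]]] := finite_type_subring s char0.
have [|P HP] := few 1; first by rewrite rmorph1 oner_eq0.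
have [p Bp pp] := prime_above (maxn B P).
have p_nonunit a : p%:R * ev a <> 1.
  by move=> E; apply: (HP p pp _ a 0); rewrite ?expr0 //; lia.
pose I : idealr A := HB.pack (mod_p_ideal ev p) (isIdealr.Build A _ (mod_p_ideal_closed p_nonunit)).
have qE a : (\pi_{ideal_quot I} a == 0) = mod_p_ideal ev p a.
  by rewrite -[0]/(0 : {ideal_quot I}) piE Quotient.equivE subr0.
exists A, {ideal_quot I}, ev, \pi_{ideal_quot I}, p; split=> //.
- rewrite inE pp /= -(rmorph_nat \pi_{ideal_quot I}) qE; apply/asboolP.
  by exists 1; rewrite rmorph1 mulr1 rmorph_nat.
- by lia.
- by move=> a a0; apply/eqP; rewrite qE; apply/asboolP; exists 0; rewrite a0 rmorph0 mulr0.
Qed.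

Local Close Scope quotient_scope.

(** * Frobenius descent *)

Lemma mcoeffMX_if (R : comNzRingType) n (p : {mpoly R[n]}) m k :
  (p * 'X_[m])@_k = if (m <= k)%MM then p@_(k - m) else 0.
Proof.
case: ifP => [mk|/negP mk]; first by rewrite -{1}(submK mk) addmC mcoeffMX.
rewrite mcoeffM big1 // => x /eqP kE; rewrite mcoeffX; case: eqP => [mE|_]; last by rewrite mulr0.
by case: mk; rewrite kE mE lem_addl.
Qed.

(** * Powers of an ideal and integral equations *)

Section PowerIdeal.
Variables (R : comNzRingType) (n : nat) (G : n.-tuple {mpoly R[n]}).

(** The m-th power of the ideal (G): ['X_[b] \mPo G] is the product of the G_i^(b_i). *)
Inductive pow_ideal (m : nat) : {mpoly R[n]} -> Prop :=
| pow_ideal0 : pow_ideal m 0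
| pow_idealD h h' : pow_ideal m h -> pow_ideal m h' -> pow_ideal m (h + h')
| pow_ideal_gen c b : (m <= mdeg b)%N -> pow_ideal m (c * ('X_[b] \mPo G)).

Lemma pow_ideal_sum m (I : Type) (s : seq I) (P : pred I) (F : I -> {mpoly R[n]}) :
  (forall i, P i -> pow_ideal m (F i)) -> pow_ideal m (\sum_(i <- s | P i) F i).
Proof. by move=> H; elim/big_ind: _ => //; [apply: pow_ideal0 | apply: pow_idealD]. Qed.

Lemma pow_idealS m m' h : (m <= m')%N -> pow_ideal m' h -> pow_ideal m h.
Proof.
move=> mm'; elim=> [|h1 h2 _ IH1 _ IH2|c b m'b]; first exact: pow_ideal0.
  exact: pow_idealD.
by apply: pow_ideal_gen; apply: leq_trans m'b.
Qed.

Lemma pow_ideal_trivial h : pow_ideal 0 h.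
Proof. by rewrite -[h]mulr1 -(rmorph1 (comp_mpoly G)) -mpolyX0; apply: pow_ideal_gen. Qed.

Lemma pow_idealM m d a h : ord_ge d a -> pow_ideal m h -> pow_ideal (m + d) ((a \mPo G) * h).
Proof.
move=> da; elim=> [|h1 h2 _ IH1 _ IH2|c b mb]; first by rewrite mulr0; apply: pow_ideal0.
  by rewrite mulrDr; apply: pow_idealD.
rewrite comp_mpolyEX mulr_suml big_seq; apply: pow_ideal_sum => k ka.
rewrite -scalerAl mulrCA -rmorphM -mpolyXD scalerAl; apply: pow_ideal_gen.
rewrite mdegD addnC leq_add // leqNgt; apply: contraL ka => /da /eqP.
by rewrite mcoeff_eq0.
Qed.

(** In w^t = sum_j a_j(G) w^(t-s+j) the factor a_j(G) contributes s - j and the induction hypothesis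
    the rest. For t < s the truncated exponent is 0. *)
Lemma pow_ideal_integral s (a : nat -> {mpoly R[n]}) w :
  (forall j, ord_ge (s - j) (a j)) -> w ^+ s = \sum_(j < s) (a j \mPo G) * w ^+ j ->
  forall t, pow_ideal (t.+1 - s) (w ^+ t).
Proof.
move=> ao ws; elim/ltn_ind => t IH; have [ts|st] := ltnP t s.
  have -> : (t.+1 - s = 0)%N by apply/eqP; rewrite subn_eq0.
  exact: pow_ideal_trivial.
rewrite -{2}(subnK st) exprD ws mulr_sumr; apply: pow_ideal_sum => j _.
rewrite mulrCA -exprD; have js := ltn_ord j.
apply: pow_idealS (pow_idealM (ao j) (IH (t - s + j)%N _)); lia.
Qed.

Lemma pow_ideal_frob p h : pow_ideal (n * p).+1 h ->
  exists c : 'I_n -> {mpoly R[n]}, h = \sum_i c i * tnth G i ^+ p.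
Proof.
elim=> [|h1 h2 _ [c1 ->] _ [c2 ->]|c b nb].
- by exists (fun=> 0); rewrite big1 // => i _; rewrite mul0r.
- by exists (fun i => c1 i + c2 i); rewrite -big_split; apply: eq_bigr => i _; rewrite mulrDl.
have [i pb] : exists i, (p <= b i)%N.
  case: (boolP [exists i, (p <= b i)%N]) => [/existsP //|].
  rewrite negb_exists => /forallP bp.
  suff : (mdeg b <= n * p)%N by rewrite leqNgt nb.
  have -> : (n * p = \sum_(i < n) p)%N by rewrite sum_nat_const card_ord.
  by rewrite mdegE; apply: leq_sum => i _; have := bp i; rewrite -ltnNge; apply: ltnW.
exists (fun j => if j == i then c * ('X_[b - U_(i) *+ p] \mPo G) else 0).
rewrite (bigD1 i) //= eqxx big1 ?addr0 => [|j /negPf ->]; last by rewrite mul0r.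
have -> : tnth G i ^+ p = 'X_[U_(i) *+ p] \mPo G by rewrite -mpolyXn rmorphXn /= comp_mpolyXU -tnth_nth.
rewrite -mulrA -rmorphM -mpolyXD submK //; apply/mnm_lepP => j; rewrite mulmnE mnm1E.
by case: eqP => [<-|_]; rewrite ?mul1n ?mul0n.
Qed.
End PowerIdeal.

Lemma inverse_mod_ord (R : comNzRingType) n (u : {mpoly R[n]}) c L :
  c * u@_0 = 1 -> exists e, ord_ge L (e * u - 1).
Proof.
move=> cu; pose v := 1 - c%:MP * u.
have v1 : ord_ge 1 v.
  move=> m; rewrite ltnS leqn0 mdeg_eq0 => /eqP ->.
  by rewrite mcoeffB mcoeffCM cu mcoeffC eqxx mulr1 subrr.
exists ((\sum_(i < L) v ^+ i) * c%:MP).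
have -> : (\sum_(i < L) v ^+ i) * c%:MP * u - 1 = - v ^+ L.
  rewrite -mulrA (_ : c%:MP * u = 1 - v); last by rewrite /v; ring.
  by rewrite mulrC -[_ - v]opprB mulNr -subrX1 opprB addrC addKr.
apply: ord_geN; elim: (L) => [|l IH]; first by move=> m.
by rewrite exprS -add1n; apply: ord_geM.
Qed.

Section Frobenius.
Variables (k : comNzRingType) (p n L : nat).
Hypothesis char_p : p \in [pchar k].
Implicit Types g h : {mpoly k[n]}.

Lemma pchar_mpoly : p \in [pchar {mpoly k[n]}].
Proof.
have := char_p; rewrite !inE => /andP [-> /eqP p0] /=.
by rewrite -mpolyC_nat p0 mpolyC0.
Qed.

Definition functional (lam : 'X_{1..n} -> k) h := \sum_(m : 'X_{1..n < L}) lam m * h@_m.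

Variable m0 : 'X_{1..n}.
Hypothesis m0p : forall i, (m0 i < p)%N.

(* The coefficient of [x^m0] in the basis of the monomials with exponents [< p] over the ring
   of polynomials in [x^p], modulo degree [L]. *)
Definition frob_proj h := \sum_(m : 'X_{1..n < L}) h@_(m0 + m *+ p) *: 'X_[m] : {mpoly k[n]}.

Lemma mcoeff_frob_proj h m : (mdeg m < L)%N -> (frob_proj h)@_m = h@_(m0 + m *+ p).
Proof. exact: (mcoeff_mpoly (fun m => h@_(m0 + m *+ p))). Qed.

Local Notation sigma := (map_mpoly (pFrobenius_aut char_p)).

(** In characteristic p, g^p is the polynomial sigma(g) evaluated at the p-th powers of the
    variables, hence a scalar for the basis of monomials with exponents below p. *)
Lemma frob_projM c g m : (mdeg m < L)%N ->
  (frob_proj (c * g ^+ p))@_m = (frob_proj c * sigma g)@_m.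
Proof.
move=> mL; rewrite mcoeff_frob_proj //.
have phiE h : h ^+ p = pFrobenius_aut pchar_mpoly h by [].
rewrite phiE (mpolyE g) !raddf_sum /= !mulr_sumr !raddf_sum /=; apply: eq_bigr => d _.
rewrite -mul_mpolyC !rmorphM /= map_mpolyC map_mpolyX !pFrobenius_autE.
rewrite -rmorphXn /= mpolyXn mulrCA mcoeffCM [in RHS]mulrCA mcoeffCM; congr (_ * _).
rewrite !mcoeffMX_if.
have -> : (d *+ p <= m0 + m *+ p)%MM = (d <= m)%MM.
  apply/mnm_lepP/mnm_lepP => H i; have := H i; rewrite mnmDE !mulmnE; have := m0p i; nia.
case: ifP => // /mnm_lepP dm.
rewrite mcoeff_frob_proj; last exact: leq_ltn_trans (mdegB _ _) mL.
congr (c@_ _); apply/mnmP => i; rewrite mnmBE !mnmDE !mulmnE mnmBE mulnBl addnBA //.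
by rewrite leq_mul2r dm orbT.
Qed.

Fact functional_is_linear lam : scalar (functional lam).
Proof.
move=> c g h; rewrite /functional mulr_sumr -big_split; apply: eq_bigr => m _.
by rewrite /= mcoeffD mcoeffZ mulrDr mulrCA.
Qed.

HB.instance Definition _ lam :=
  GRing.isLinear.Build k {mpoly k[n]} k *%R (functional lam) (functional_is_linear lam).

Lemma functional_eq lam g h :
  (forall m, (mdeg m < L)%N -> g@_m = h@_m) -> functional lam g = functional lam h.
Proof. by move=> gh; apply: eq_bigr => m _; rewrite gh // bmdeg. Qed.

Lemma functional_sigma lam h :
  functional (fun m => lam m ^+ p) (sigma h) = functional lam h ^+ p.
Proof.
rewrite /functional -[RHS]/(pFrobenius_aut char_p (\sum_(m : 'X_{1..n < L}) lam m * h@_m)).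
rewrite [RHS]raddf_sum; apply: eq_bigr => m _.
by rewrite mcoeff_map_mpoly /= !pFrobenius_autE exprMn.
Qed.

(** Writing pi for [frob_proj], projecting w^s w^(np) = sum_i b_i G_i^p gives pi(w^s) sigma(w^n) =
    sum_i pi(b_i) sigma(G_i) modulo degree L. The factor pi(w^s) is a unit there, its constant term
    being the coefficient of w^s at [m0]. Raising the values of [lam] to the p-th power gives a
    functional that kills the ideal of the sigma(G_i) and takes the value lam(w^n)^p at
    sigma(w^n). *)
Lemma frobenius_descent (G : n.-tuple {mpoly k[n]}) s (a : nat -> {mpoly k[n]}) w lam c :
  (forall j, ord_ge (s - j) (a j)) -> w ^+ s = \sum_(j < s) (a j \mPo G) * w ^+ j ->
  c * (w ^+ s)@_m0 = 1 ->
  (forall i m, functional lam ('X_[m] * tnth G i) = 0) ->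
  functional lam (w ^+ n) ^+ p = 0.
Proof.
move=> ao ws wc lamG.
have [b wE] : exists b : 'I_n -> {mpoly k[n]}, w ^+ (s + n * p) = \sum_i b i * tnth G i ^+ p.
  apply: pow_ideal_frob; apply: pow_idealS (pow_ideal_integral ao ws _); lia.
pose mu m := lam m ^+ p.
have [L0|L0] := posnP L.
  rewrite /functional big1 => [|m]; last by move: (leq_ltn_trans (leq0n _) (bmdeg m)); rewrite {1}L0.
  by rewrite expr0n; case: (p) (prime_gt0 (pcharf_prime char_p)).
have ordE g h : ord_ge L (g - h) -> functional mu g = functional mu h.
  by move=> gh; apply: functional_eq => m /gh /eqP; rewrite mcoeffB subr_eq0 => /eqP.
have [e eE] : exists e, ord_ge L (e * frob_proj (w ^+ s) - 1).
  apply: (@inverse_mod_ord _ _ _ c); rewrite mcoeff_frob_proj ?mdeg0 //.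
  by rewrite (_ : m0 + 0 *+ p = m0)%MM //; apply/mnmP => i; rewrite mnmDE mulmnE mnm0E mul0n addn0.
rewrite -functional_sigma -/mu.
transitivity (functional mu (e * (frob_proj (w ^+ s) * sigma (w ^+ n)))).
  apply/esym/ordE; rewrite mulrA -{2}[sigma _]mul1r -mulrBl -[L]addn0.
  by apply: ord_geM => // m.
transitivity (functional mu (e * \sum_i frob_proj (b i) * sigma (tnth G i))).
  apply: ordE; rewrite -mulrBr -[L]add0n; apply: ord_geM => [m //|m mL].
  rewrite mcoeffB -frob_projM // -exprM -exprD wE mcoeff_frob_proj // !(raddf_sum (mcoeff _)) -sumrB.
  by rewrite big1 // => i _; rewrite /= -frob_projM // mcoeff_frob_proj // subrr.
have muG i h : functional mu (h * sigma (tnth G i)) = 0.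
  rewrite (mpolyE h) mulr_suml raddf_sum big1 // => m _ /=.
  have sX : 'X_[m] = sigma 'X_[m] by rewrite map_mpolyX.
  rewrite -scalerAl linearZ /= sX.
  by rewrite -rmorphM /mu functional_sigma lamG expr0n; case: (p) (prime_gt0 (pcharf_prime char_p)) => //= *; rewrite mulr0.
by rewrite mulr_sumr raddf_sum big1 // => i _; rewrite mulrA; apply: muG.
Qed.
End Frobenius.

(** * Powers in the gradient ideal *)

Lemma map_mpoly_comp_mpoly (R S : comNzRingType) (f : {rmorphism R -> S}) n k
    (G : n.-tuple {mpoly R[k]}) (a : {mpoly R[n]}) :
  map_mpoly f (a \mPo G) = map_mpoly f a \mPo [tuple map_mpoly f (tnth G i) | i < n].
Proof.
elim/mpolyind: a => [|c m p _ _ IH]; first by rewrite !rmorph0.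
rewrite -mul_mpolyC !(rmorphD, rmorphM) /= IH comp_mpolyC !map_mpolyC comp_mpolyC map_mpolyX !comp_mpolyX.
by rewrite rmorph_prod /=; congr (_ * _ + _); apply: eq_bigr => i _; rewrite rmorphXn tnth_mktuple.
Qed.

Section Lift.
Variables (A : comNzRingType) (K : fieldType) (ev : {rmorphism A -> K}) (n : nat).

(** Vanishing coefficients are lifted to 0 itself, so the lifts of the a_j keep their orders. *)
Lemma mpoly_lift (g : {mpoly K[n]}) : (forall m, m \in msupp g -> exists a, ev a = g@_m) ->
  exists h : {mpoly A[n]}, map_mpoly ev h = g /\ forall m, g@_m = 0 -> h@_m = 0.
Proof.
elim/mpolyind: g => [|c m p mp c0 IH] H.
  by exists 0; split=> [|m _]; rewrite ?rmorph0 ?mcoeff0.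
have pm : p@_m = 0 by apply: memN_msupp_eq0.
have coefE k : (c *: 'X_[m] + p)@_k = if k == m then c else p@_k.
  rewrite mcoeffD mcoeffZ mcoeffX eq_sym; case: eqP => [->|_]; first by rewrite mulr1 pm addr0.
  by rewrite mulr0 add0r.
have [|a aE] := H m; first by rewrite mcoeff_msupp coefE eqxx.
have [k kp|h [hE h0]] := IH.
  have km : (k == m) = false by apply: contraNF mp => /eqP <-.
  by have := H k; rewrite mcoeff_msupp coefE km -mcoeff_msupp; apply.
exists (a%:MP * 'X_[m] + h); split=> [|k].
  apply/mpolyP => k; rewrite mcoeff_map_mpoly /= coefE mcoeffD mcoeffCM mcoeffX rmorphD rmorphM /=.
  have -> : ev h@_k = p@_k by rewrite -hE mcoeff_map_mpoly.
  rewrite aE coefE eqxx eq_sym rmorph_nat.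
  by case: eqP => [->|_]; rewrite ?pm ?mulr1 ?addr0 // mulr0 add0r.
rewrite coefE mcoeffD mcoeffCM mcoeffX eq_sym; case: eqP => [_ /eqP|_ /h0 ->]; first by rewrite (negPf c0).
by rewrite mulr0 addr0.
Qed.
End Lift.

(** * Duality modulo high order *)

Section Duality.
Variables (K : fieldType) (n L : nat) (G : 'I_n -> {mpoly K[n]}) (v : {mpoly K[n]}).

(** Modulo degree L the ideal is the row space of the finite matrix [A], and a vector outside a row
    space is detected by a column of the cokernel matrix. *)
Lemma ideal_or_functional :
  (exists h : 'I_n -> {mpoly K[n]}, ord_ge L (v - \sum_i h i * G i)) \/
  (exists lam : 'X_{1..n} -> K, functional L lam v = 1 /\
     forall i m, functional L lam ('X_[m] * G i) = 0).
Proof.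
pose I : finType := ('I_n * 'X_{1..n < L})%type; pose J : finType := 'X_{1..n < L}.
pose A : 'M[K]_(#|I|, #|J|) := \matrix_(r < #|I|, c < #|J|)
  ('X_[(enum_val r).2] * G (enum_val r).1)@_(enum_val c).
pose V := \row_(c < #|J|) v@_(enum_val c) : 'rV[K]_#|J|.
have [/submxP [D VE]|] := boolP (V <= A)%MS.
  left; exists (fun i => \sum_(m : 'X_{1..n < L}) D 0 (enum_rank (i, m)) *: 'X_[m]).
  move=> m mL; pose mm : J := BMultinom mL.
  have /rowP /(_ (enum_rank mm)) := VE; rewrite !mxE enum_rankK /= mcoeffB => ->.
  apply/eqP; rewrite subr_eq0 raddf_sum /=; apply/eqP.
  transitivity (\sum_(x : I) D 0 (enum_rank x) * ('X_[x.2] * G x.1)@_m).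
    rewrite (reindex (@enum_val I xpredT)) /=; last first.
      by exists enum_rank => x _; rewrite ?enum_valK ?enum_rankK.
    by apply: eq_bigr => r _; rewrite mxE enum_valK enum_rankK.
  transitivity (\sum_(i < n) \sum_(k : 'X_{1..n < L}) D 0 (enum_rank ((i, k) : I)) * ('X_[k] * G i)@_m).
    by rewrite pair_bigA; apply: eq_bigr => -[].
  apply: eq_bigr => i _; rewrite mulr_suml raddf_sum; apply: eq_bigr => k _.
  by rewrite /= -scalerAl mcoeffZ.
rewrite submxE => /rV0Pn [j vj]; right.
set c := (_ *m _) _ _ in vj.
pose mu (m : J) := cokermx A (enum_rank m) j / c.
pose lam m := oapp mu 0 (insub m).
have lamE (m : J) : lam m = mu m by rewrite /lam valK.
exists lam; split.
  rewrite /functional (reindex (@enum_val J xpredT)) /=; last first.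
    by exists enum_rank => x _; rewrite ?enum_valK ?enum_rankK.
  rewrite -(divff vj) {1}/c mxE mulr_suml; apply: eq_bigr => i _.
  by rewrite lamE /mu enum_valK [V 0 i]mxE mulrC mulrA.
move=> i m; have [mL|Lm] := ltnP (mdeg m) L; last first.
  apply: big1 => k _; rewrite ['X_[m] * _]mulrC mcoeffMX_if; case: ifP => [mk|_]; rewrite ?mulr0 //.
  have := bmdeg k; rewrite ltnNge (leq_trans Lm) //.
  by rewrite -(submK mk) mdegD leq_addl.
pose r := enum_rank ((i, BMultinom mL) : I).
have /matrixP /(_ r j) := mulmx_coker A; rewrite mxE [RHS]mxE => E.
rewrite -[RHS](mul0r c^-1) -E mulr_suml /functional (reindex (@enum_val J xpredT)) /=; last first.
  by exists enum_rank => x _; rewrite ?enum_valK ?enum_rankK.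
by apply: eq_bigr => k _; rewrite lamE /mu enum_valK [A r k]mxE /r enum_rankK /= mulrC mulrA.
Qed.
End Duality.

Section GradientPower.
Variables (K : fieldType) (n : nat).
Hypothesis char0 : forall k, k.+1%:R != 0 :> K.
Hypothesis n_gt0 : (0 < n)%N.

Lemma no_functional (L : nat) (G : n.-tuple {mpoly K[n]}) s a (w : {mpoly K[n]}) lam :
  (forall j, ord_ge (s - j) (a j)) -> w ^+ s = \sum_(j < s) (a j \mPo G) * w ^+ j ->
  functional L lam (w ^+ n) = 1 -> ~ (forall i m, functional L lam ('X_[m] * tnth G i) = 0).
Proof.
move=> ao ws lam1 lam0.
have wn0 : w ^+ s != 0.
  rewrite expf_neq0 //; apply/eqP => w0; move/eqP: lam1.
  by rewrite w0 expr0n gtn_eqF // raddf0 eq_sym oner_eq0.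
(* Any nonzero coefficient of w^s would do. Its inverse is put among the data so that it stays
   invertible modulo p, and p larger than the degree of [m0] bounds the exponents of [m0]. *)
pose m0 := mlead (w ^+ s); pose c := ((w ^+ s)@_m0)^-1.
have c0 : c * (w ^+ s)@_m0 = 1 by rewrite mulVf // mleadc_eq0.
pose coefs (g : {mpoly K[n]}) := [seq g@_m | m <- msupp g].
pose S := c :: coefs w ++ flatten [seq coefs (tnth G i) | i : 'I_n]
  ++ flatten [seq coefs (a (nat_of_ord j)) | j : 'I_s] ++ [seq lam (bmnm m) | m : 'X_{1..n < L}].
have [A [k [ev [q [p [char_p mp evq evS]]]]]] := reduction_mod_p S (mdeg m0) char0.
have lift g : {subset coefs g <= S} -> exists h : {mpoly A[n]},
    map_mpoly ev h = g /\ forall m, g@_m = 0 -> h@_m = 0.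
  by move=> gS; apply: mpoly_lift => m mg; apply/evS/gS/map_f.
have [c' c'E] : exists c', ev c' = c by apply: evS; rewrite inE eqxx.
have [|w' [w'E _]] := lift w.
  by move=> x xw; rewrite inE mem_cat xw orbT.
have /choice [G' G'E] : forall i, exists h, map_mpoly ev h = tnth G i.
  move=> i; have [|h [hE _]] := lift (tnth G i); last by exists h.
  move=> x xG; rewrite inE !mem_cat; apply/orP; right; apply/orP; right; apply/orP; left.
  by apply/flattenP; exists (coefs (tnth G i)) => //; apply/imageP; exists i.
have /choice [a' a'E] : forall j : nat, exists h : {mpoly A[n]},
    (j < s)%N -> map_mpoly ev h = a j /\ forall m, (a j)@_m = 0 -> h@_m = 0.
  move=> j; have [js|js] := ltnP j s; last by exists 0.
  have [|h hE] := lift (a j); last by exists h.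
  move=> x xG; rewrite inE !mem_cat; do 3!(apply/orP; right); apply/orP; left.
  by apply/flattenP; exists (coefs (a j)) => //; apply/imageP; exists (Ordinal js).
have /choice [lam' lam'E] : forall m, exists l, (mdeg m < L)%N -> ev l = lam m.
  move=> m; have [mL|mL] := ltnP (mdeg m) L; last by exists 0.
  have [|l lE] := evS (lam m); last by exists l.
  rewrite inE !mem_cat; do 4!(apply/orP; right).
  by apply/imageP; exists (BMultinom mL).
have mcoeff_ev (h : {mpoly A[n]}) m : (map_mpoly ev h)@_m = ev h@_m by apply: mcoeff_map_mpoly.
have mcoeff_q (h : {mpoly A[n]}) m : (map_mpoly q h)@_m = q h@_m by apply: mcoeff_map_mpoly.
have evq_mpoly (h : {mpoly A[n]}) : map_mpoly ev h = 0 -> map_mpoly q h = 0.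
  move=> h0; apply/mpolyP => m; rewrite mcoeff_q mcoeff0 evq //.
  by rewrite -mcoeff_ev h0 mcoeff0.
have functional_map (B : comNzRingType) (f : {rmorphism A -> B}) h :
    f (functional L lam' h) = functional L (f \o lam') (map_mpoly f h).
  rewrite /functional rmorph_sum; apply: eq_bigr => m _.
  by rewrite rmorphM /= mcoeff_map_mpoly.
have functional_ev h : functional L (ev \o lam') h = functional L lam h.
  by apply: eq_bigr => m _; rewrite /= lam'E // bmdeg.
pose Gq := [tuple map_mpoly q (G' i) | i < n].
have := @frobenius_descent k p n L char_p m0 _ Gq s (fun j => map_mpoly q (a' j))
  (map_mpoly q w') (q \o lam') (q c').
have -> : functional L (q \o lam') (map_mpoly q w' ^+ n) = 1.
  rewrite -rmorphXn -functional_map; apply/eqP; rewrite -subr_eq0 -(rmorph1 q) -rmorphB.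
  by rewrite evq // rmorphB functional_map rmorphXn /= w'E functional_ev lam1 rmorph1 subrr.
rewrite expr1n => H; suff /eqP : 1 = 0 :> k by rewrite oner_eq0.
apply: H.
- move=> i; apply: leq_ltn_trans mp; rewrite mdegE (bigD1 i) //=; exact: leq_addr.
- move=> j m mj; rewrite mcoeff_q; have js : (j < s)%N by lia.
  by rewrite (a'E j js).2 ?rmorph0 //; apply: ao.
- pose H := w' ^+ s - \sum_(j < s) (a' j \mPo [tuple G' i | i < n]) * w' ^+ j.
  have compE (B : comNzRingType) (f : {rmorphism A -> B}) : map_mpoly f H = map_mpoly f w' ^+ s -
      \sum_(j < s) (map_mpoly f (a' j) \mPo [tuple map_mpoly f (G' i) | i < n]) * map_mpoly f w' ^+ j.
    rewrite rmorphB rmorphXn rmorph_sum /=; congr (_ - _); apply: eq_bigr => j _.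
    rewrite rmorphM /= map_mpoly_comp_mpoly [map_mpoly f (w' ^+ j)]rmorphXn /=.
    have -> : [tuple map_mpoly f (tnth [tuple G' i | i < n] i) | i < n] = [tuple map_mpoly f (G' i) | i < n].
      by apply: eq_from_tnth => i; rewrite !tnth_mktuple.
    by [].
  have /evq_mpoly : map_mpoly ev H = 0.
    rewrite compE w'E ws; apply/eqP; rewrite subr_eq0; apply/eqP; apply: eq_bigr => j _.
    rewrite (a'E j (ltn_ord j)).1; congr ((_ \mPo _) * _).
    by apply: eq_from_tnth => i; rewrite tnth_mktuple G'E.
  by rewrite compE => /eqP; rewrite subr_eq0 => /eqP.
- rewrite -rmorphXn /= mcoeff_q -rmorphM; apply/eqP; rewrite -subr_eq0 -(rmorph1 q) -rmorphB.
  by rewrite evq // rmorphB rmorphM rmorph1 c'E -mcoeff_ev rmorphXn /= w'E c0 subrr.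
- move=> i m; rewrite tnth_mktuple -(map_mpolyX q) -rmorphM -functional_map evq //.
  by rewrite functional_map functional_ev rmorphM /= map_mpolyX G'E lam0.
Qed.

Lemma gradient_ideal_dominant (M L : nat) (F : {mpoly K[n]}) :
  (forall i, top_monom (U_(i) *+ M.+1) F^`M(i)) -> F@_0 = 0 ->
  exists h : 'I_n -> {mpoly K[n]}, ord_ge L (F ^+ n - \sum_i h i * F^`M(i)).
Proof.
move=> topF F0; have [V [s [a [V0 ao ws]]]] := integral_over_gradient char0 topF.
set w := F * _ in ws.
have [[h hE]|[lam [lam1 lam0]]] := ideal_or_functional L (fun i => F^`M(i)) (w ^+ n); last first.
  by case: (no_functional ao ws lam1) => i m; rewrite tnth_mktuple.
pose u := (map_poly (@mpolyC n K) V).[F] ^+ n.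
have u0 : u@_0 = V`_0 ^+ n.
  rewrite /u rmorphXn /=; congr (_ ^+ _).
  rewrite -horner_map /= F0 -map_poly_comp horner_coef0 coef_map /=.
  by rewrite mcoeffC eqxx mulr1.
have [|e eE] := @inverse_mod_ord _ _ u (u@_0)^-1 L.
  by rewrite mulVf // u0 expf_neq0.
exists (fun i => e * h i).
have -> : F ^+ n - \sum_i e * h i * F^`M(i) =
    e * (w ^+ n - \sum_i h i * F^`M(i)) + - ((e * u - 1) * F ^+ n).
  rewrite mulrBr mulr_sumr /w exprMn -/u.
  rewrite (eq_bigr (fun i => e * (h i * F^`M(i)))) => [|i _]; last by rewrite mulrA.
  ring.
apply: ord_geD; first by rewrite -[L]add0n; apply: ord_geM => // m.
by apply: ord_geN; rewrite -[L]addn0; apply: ord_geM => // m.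
Qed.

Lemma pow_in_gradient_ideal (L : nat) (F : {mpoly K[n]}) : F@_0 = 0 ->
  exists h : 'I_n -> {mpoly K[n]}, ord_ge L (F ^+ n - \sum_i h i * F^`M(i)).
Proof.
(* M >= msize F keeps the partial derivatives of F below degree M + 1, and M >= L makes [E] and its
   derivatives vanish below degree L. *)
move=> F0; pose M := (L + msize F)%N.
pose E := \sum_i (M.+2%:R)^-1 *: 'X_[U_(i) *+ M.+2] : {mpoly K[n]}.
have E_ord : ord_ge M.+2 E.
  apply: ord_ge_sum => i _ m mM; rewrite mcoeffZ mcoeffX.
  by case: eqP => [mE|_]; rewrite ?mulr0 //; move: mM; rewrite -mE mdegMn mdeg1 mul1n ltnn.
have dE i : E^`M(i) = 'X_[U_(i) *+ M.+1].
  rewrite raddf_sum (bigD1 i) //= big1 ?addr0 => [|j /negPf ji].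
    rewrite mderivZ mderivX mulmnE mnm1E eqxx mul1n scalerA mulVf ?scale1r //; congr 'X_[_].
    by apply/mnmP => j; rewrite mnmBE !mulmnE mulnS addKn.
  by rewrite mderivZ mderivX mulmnE mnm1E ji mul0n scale0r scaler0.
have [i||h hE] := @gradient_ideal_dominant M L (F + E).
- rewrite mderivD dE /top_monom addrK mdegMn mdeg1 mul1n.
  apply: deg_lt_mderiv; apply: deg_ltS (@deg_lt_msize _ _ F).
  by rewrite /M -addn2 -addnA addnCA leq_addr.
- by rewrite mcoeffD F0 E_ord ?addr0 // mdeg0.
exists h.
have -> : F ^+ n - \sum_i h i * F^`M(i) =
  ((F + E) ^+ n - \sum_i h i * (F + E)^`M(i)) +
  (\sum_i h i * 'X_[U_(i) *+ M.+1] - ((F + E) ^+ n - F ^+ n)).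
  have -> : \sum_i h i * (F + E)^`M(i) = \sum_i h i * F^`M(i) + \sum_i h i * 'X_[U_(i) *+ M.+1].
    by rewrite -big_split; apply: eq_bigr => i _; rewrite mderivD dE mulrDr.
  ring.
apply: ord_geD => //; apply: ord_geD.
  apply: ord_ge_sum => i _; rewrite -[L]add0n; apply: ord_geM => [m //|].
  move=> m mL; rewrite mcoeffX; case: eqP => // mE; move: mL.
  by rewrite -mE mdegMn mdeg1 mul1n /M; lia.
apply: ord_geN; rewrite subrXX addrC addKr -[L]addn0; apply: ord_geM => [|m //].
apply: ord_geS E_ord; rewrite /M; lia.
Qed.
End GradientPower.

End GradientIdeal.

From mathcomp Require Import complex.
From mathcomp Require Import all_classical all_reals.
From mathcomp Require Import -(notations) mpoly.
Import GradientIdeal.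
Import Order.TTheory GRing.Theory Num.Theory.
Local Open Scope ring_scope.

(** * The ring of power series *)

Definition to_mi n (m : multinom n) : mi n := [ffun i => m i].
Definition of_mi n (c : mi n) : multinom n := Multinom [tuple c i | i < n].

Lemma of_miE n (c : mi n) i : of_mi c i = c i.
Proof. by rewrite multinomE tnth_mktuple. Qed.

Lemma to_miK n : cancel (@to_mi n) (@of_mi n).
Proof. by move=> m; apply/mnmP => i; rewrite of_miE ffunE. Qed.

Lemma of_miK n : cancel (@of_mi n) (@to_mi n).
Proof. by move=> c; apply/ffunP => i; rewrite ffunE of_miE. Qed.

Lemma mdeg_of_mi n (c : mi n) : mdeg (of_mi c) = Defs.mdeg c.
Proof. by rewrite mdegE; apply: eq_bigr => i _; rewrite of_miE. Qed.

Lemma mi_le_mdeg n (c : mi n) i : (c i <= Defs.mdeg c)%N.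
Proof. by rewrite /Defs.mdeg (bigD1 i) //= leq_addr. Qed.

Lemma mi_mdeg0 n : Defs.mdeg (mi0 n) = 0%N.
Proof. by rewrite /Defs.mdeg big1 // => i _; rewrite ffunE. Qed.

Section Ring.
Variables (R : realType) (n : nat).
Local Notation C := R[i].
Local Notation poly := (mpoly n C).

(* An alias is needed: the function type [ps C n] already carries the pointwise product. *)
Definition fps : Type := ps C n.
Implicit Types f g h : fps.

HB.instance Definition _ := gen_eqMixin fps.
HB.instance Definition _ := gen_choiceMixin fps.

Definition trunc (d : nat) f : poly := \sum_(m : bmultinom n d) f (to_mi m) *: mpolyX C m.
Definition ps_of (p : poly) : fps := fun c => mcoeff (of_mi c) p.

Lemma mcoeff_trunc d f c : (Defs.mdeg c < d)%N -> mcoeff (of_mi c) (trunc d f) = f c.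
Proof.
rewrite -mdeg_of_mi => cd; rewrite (mcoeff_mpoly (fun m => f (to_mi m))) //.
by rewrite of_miK.
Qed.

Lemma trunc_ps_of d p : ord_ge d (trunc d (ps_of p) - p).
Proof.
move=> m md; rewrite mcoeffB (mcoeff_mpoly (fun m => ps_of p (to_mi m))) //.
by rewrite /ps_of to_miK subrr.
Qed.

(** Each coefficient of a Cauchy product is a coefficient of a product of polynomials; the ring
    axioms for series are inherited in this way. *)
Lemma ps_mul_trunc d f g c : (Defs.mdeg c < d)%N ->
  ps_mul f g c = mcoeff (of_mi c) (trunc d f * trunc d g).
Proof.
move=> cd; have cd' : (mdeg (of_mi c) < (Defs.mdeg c).+1)%N by rewrite mdeg_of_mi.
rewrite [RHS](mcoeff_poly_mul_lin _ _ cd').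
pose h (m : bmultinom n (Defs.mdeg c).+1) : {ffun 'I_n -> 'I_(Defs.mdeg c).+1} := [ffun i => inord (m i)].
pose h' (b : {ffun 'I_n -> 'I_(Defs.mdeg c).+1}) : bmultinom n (Defs.mdeg c).+1 :=
  insubd (bm0 : bmultinom n (Defs.mdeg c).+1) (Multinom [tuple (b i : nat) | i < n]).
have hval (m : bmultinom n (Defs.mdeg c).+1) i : h m i = m i :> nat.
  rewrite ffunE inordK //; apply: leq_ltn_trans (bmdeg m).
  by rewrite mdegE (bigD1 i) //= leq_addr.
have h'val (b : {ffun 'I_n -> 'I_(Defs.mdeg c).+1}) : [forall i, (b i <= c i)%N] -> h' b = Multinom [tuple (b i : nat) | i < n] :> multinom n.
  move=> /forallP bc; rewrite /h' val_insubd ifT // ltnS mdegE.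
  by apply: leq_sum => i _; rewrite multinomE tnth_mktuple.
clearbody h h'.
rewrite /ps_mul (reindex_onto h h') /= => [|b bc]; last first.
  by apply/ffunP => i; apply: val_inj; have := hval (h' b) i; rewrite h'val // multinomE tnth_mktuple.
apply: eq_big => [m|m].
  have hc : [forall i, (h m i <= c i)%N] = lem m (of_mi c).
    apply/forallP/mnm_lepP => H i; have := H i; rewrite hval ?of_miE //.
  rewrite hc andb_idr // -hc => /h'val hm; apply/eqP/val_inj/mnmP => i.
  by rewrite [LHS](congr1 (fun m : multinom n => m i) hm) multinomE tnth_mktuple hval.
move=> /andP [/forallP hc _].
have <- : to_mi m = [ffun i => nat_of_ord (h m i)] by apply/ffunP => i; rewrite !ffunE hval.
have mc : (mdeg m <= mdeg (of_mi c))%N.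
  by rewrite !mdegE; apply: leq_sum => i _; rewrite of_miE -hval.
rewrite -(@mcoeff_trunc d f) ?to_miK; last first.
  by rewrite -mdeg_of_mi to_miK (leq_ltn_trans mc) // mdeg_of_mi.
congr (_ * _); rewrite -(@mcoeff_trunc d g); last first.
  apply: leq_ltn_trans cd; apply: leq_sum => i _; rewrite ffunE; exact: leq_subr.
congr (mcoeff _ _); apply/mnmP => i; rewrite of_miE ffunE mnmBE of_miE hval //.
Qed.

Lemma mcoeffM_ord d (p p' q q' : poly) m : (mdeg m < d)%N ->
  ord_ge d (p - p') -> ord_ge d (q - q') -> mcoeff m (p * q) = mcoeff m (p' * q').
Proof.
move=> md pp qq; apply/eqP; rewrite -subr_eq0 -mcoeffB.
have -> : p * q - p' * q' = (p - p') * q + p' * (q - q') by ring.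
have H : ord_ge d ((p - p') * q + p' * (q - q')).
  apply: ord_geD; first by rewrite -[d]addn0; apply: ord_geM.
  by rewrite -[d]add0n; apply: ord_geM.
by rewrite H.
Qed.

Lemma trunc_mul d f g : ord_ge d (trunc d (ps_mul f g : fps) - trunc d f * trunc d g).
Proof.
move=> m md; have cd : (Defs.mdeg (to_mi m) < d)%N by rewrite -mdeg_of_mi to_miK.
by rewrite mcoeffB -{1}(to_miK m) mcoeff_trunc // (ps_mul_trunc _ _ cd) to_miK subrr.
Qed.

Definition fps0 : fps := fun _ : mi n => 0.
Definition fps_opp f : fps := fun c => - f c.
Definition fps_add f g : fps := fun c => f c + g c.
Definition fps_mul f g : fps := ps_mul f g.
Definition fps_one : fps := @ps_one R n.

Fact fps_addA : associative fps_add.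
Proof. by move=> f g h; apply/funext => c; apply: addrA. Qed.
Fact fps_addC : commutative fps_add.
Proof. by move=> f g; apply/funext => c; apply: addrC. Qed.
Fact fps_add0 : left_id fps0 fps_add.
Proof. by move=> f; apply/funext => c; apply: add0r. Qed.
Fact fps_addN : left_inverse fps0 fps_opp fps_add.
Proof. by move=> f; apply/funext => c; apply: addNr. Qed.

HB.instance Definition _ := GRing.isZmodule.Build fps fps_addA fps_addC fps_add0 fps_addN.

Lemma fpsD f g c : (f + g) c = f c + g c. Proof. by []. Qed.
Lemma fpsN f c : (- f) c = - f c. Proof. by []. Qed.
Lemma fps_sum (I : Type) (s : seq I) (P : pred I) (F : I -> fps) c :
  (\sum_(i <- s | P i) F i) c = \sum_(i <- s | P i) F i c.
Proof. by elim/big_rec2: _ => // i x y _ <-. Qed.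

Lemma truncD d f g : trunc d (f + g) = trunc d f + trunc d g.
Proof. by rewrite /trunc -big_split; apply: eq_bigr => m _; rewrite fpsD scalerDl. Qed.

Lemma trunc1 d : ord_ge d (trunc d fps_one - 1).
Proof.
move=> m md; rewrite mcoeffB (mcoeff_mpoly (fun m => fps_one (to_mi m))) // mcoeff1.
by rewrite /fps_one /ps_one -mdeg_of_mi to_miK mdeg_eq0 subrr.
Qed.

Fact fps_mulA : associative fps_mul.
Proof.
move=> f g h; apply/funext => c; have cd := ltnSn (Defs.mdeg c).
have cd' : (mdeg (of_mi c) < (Defs.mdeg c).+1)%N by rewrite mdeg_of_mi.
rewrite /fps_mul !(ps_mul_trunc _ _ cd).
rewrite (mcoeffM_ord cd' (p' := trunc (Defs.mdeg c).+1 f) _ (@trunc_mul _ g h)) ?subrr //.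
rewrite (mcoeffM_ord cd' (@trunc_mul _ f g) (q' := trunc (Defs.mdeg c).+1 h)) ?subrr ?mulrA //.
all: exact: ord_ge0.
Qed.
Fact fps_mulC : commutative fps_mul.
Proof.
move=> f g; apply/funext => c; have cd := ltnSn (Defs.mdeg c).
by rewrite /fps_mul !(ps_mul_trunc _ _ cd) mulrC.
Qed.
Fact fps_mul1 : left_id fps_one fps_mul.
Proof.
move=> f; apply/funext => c; have cd := ltnSn (Defs.mdeg c).
have cd' : (mdeg (of_mi c) < (Defs.mdeg c).+1)%N by rewrite mdeg_of_mi.
rewrite /fps_mul (ps_mul_trunc _ _ cd) (mcoeffM_ord cd' (@trunc1 _) (q' := trunc (Defs.mdeg c).+1 f)).
  by rewrite mul1r mcoeff_trunc.
by rewrite subrr; apply: ord_ge0.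
Qed.
Fact fps_mulDl : left_distributive fps_mul (@GRing.add fps).
Proof.
move=> f g h; apply/funext => c; have cd := ltnSn (Defs.mdeg c).
by rewrite fpsD /fps_mul !(ps_mul_trunc _ _ cd) truncD mulrDl mcoeffD.
Qed.
Fact fps_oner : fps_one != 0.
Proof.
apply/eqP => /(congr1 (fun f : fps => f (mi0 n))); rewrite /fps_one /ps_one.
have -> : Defs.mdeg (mi0 n) = 0%N by rewrite /Defs.mdeg big1 // => i _; rewrite ffunE.
by move/eqP; rewrite oner_eq0.
Qed.

HB.instance Definition _ := GRing.Zmodule_isComNzRing.Build fps
  fps_mulA fps_mulC fps_mul1 fps_mulDl fps_oner.

Lemma fpsM_trunc d f g c : (Defs.mdeg c < d)%N ->
  (f * g) c = mcoeff (of_mi c) (trunc d f * trunc d g).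
Proof. exact: ps_mul_trunc. Qed.

Lemma ps_ofM_trunc d p g c : (Defs.mdeg c < d)%N ->
  (ps_of p * g) c = mcoeff (of_mi c) (p * trunc d g).
Proof.
move=> cd; rewrite (fpsM_trunc _ _ cd).
apply: (@mcoeffM_ord d); rewrite ?mdeg_of_mi ?subrr //; first exact: trunc_ps_of.
exact: ord_ge0.
Qed.

Fact ps_of_is_zmod_morphism : zmod_morphism ps_of.
Proof. by move=> p q; apply/funext => c; rewrite /ps_of mcoeffB. Qed.
Fact ps_of_is_monoid_morphism : monoid_morphism ps_of.
Proof.
split.
  by apply/funext => c; rewrite /ps_of mcoeff1 -mdeg_eq0 mdeg_of_mi.
move=> p q; apply/funext => c; rewrite (ps_ofM_trunc _ _ (ltnSn _)).
apply: (@mcoeffM_ord (Defs.mdeg c).+1); rewrite ?mdeg_of_mi ?subrr //; first exact: ord_ge0.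
by rewrite -opprB; apply/ord_geN/trunc_ps_of.
Qed.
HB.instance Definition _ := GRing.isZmodMorphism.Build poly fps ps_of ps_of_is_zmod_morphism.
HB.instance Definition _ := GRing.isMonoidMorphism.Build poly fps ps_of ps_of_is_monoid_morphism.

Lemma ps_ofC a g c : (ps_of (mpolyC n a) * g) c = a * g c.
Proof. by rewrite (ps_ofM_trunc _ _ (ltnSn _)) mcoeffCM mcoeff_trunc. Qed.

Lemma ps_ofXM m g c : (ps_of (mpolyX C m) * g) c =
  if lem m (of_mi c) then g (to_mi (mnm_sub (of_mi c) m)) else 0.
Proof.
rewrite (ps_ofM_trunc _ _ (ltnSn _)) mulrC mcoeffMX_if; case: ifP => // /mnm_lepP mc.
rewrite -(@mcoeff_trunc (Defs.mdeg c).+1); first by rewrite to_miK.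
rewrite -mdeg_of_mi to_miK ltnS -mdeg_of_mi !mdegE.
by apply: leq_sum => i _; rewrite mnmBE leq_subr.
Qed.

Lemma ps_expE (f : fps) k : ps_exp f k = f ^+ k.
Proof. by elim: k => // k IH; rewrite exprS -IH. Qed.

Lemma fpsM0 f g : (f * g) (mi0 n) = f (mi0 n) * g (mi0 n).
Proof.
rewrite (fpsM_trunc (d := 1%N)) ?mi_mdeg0 //.
have -> : of_mi (mi0 n) = mnm0 by apply/mnmP => i; rewrite of_miE ffunE mnm0E.
have E h : mcoeff mnm0 (trunc 1 h) = h (mi0 n).
  by rewrite -(@mcoeff_trunc 1) ?mi_mdeg0 //; congr mcoeff; apply/mnmP => i; rewrite of_miE ffunE mnm0E.
by rewrite rmorphM /= !E.
Qed.

End Ring.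

(** * Convergent series *)

Import ComplexField.Normc.

Section Conv.
Variables (R : realType) (n : nat).
Local Notation C := R[i].
Local Notation fps := (fps R n).
Implicit Types f g h : fps.

Lemma normc_ge0 (z : C) : 0 <= normc z.
Proof. by case: z => a b; apply: sqrtr_ge0. Qed.

Lemma normcX (z : C) k : normc (z ^+ k) = normc z ^+ k.
Proof. by elim: k => [|k IH]; rewrite ?normc1 // !exprS normcM IH. Qed.

Lemma normc_nat k : normc (k%:R : C) = k%:R.
Proof. by rewrite normcMn normc1. Qed.

Lemma le_normc_sum (I : Type) (s : seq I) (P : pred I) (F : I -> C) :
  normc (\sum_(i <- s | P i) F i) <= \sum_(i <- s | P i) normc (F i).
Proof.
elim/big_rec2: _ => [|i x y _ xy]; first by rewrite normc0.
by apply: le_trans (le_normcD _ _) _; rewrite lerD2l.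
Qed.

Definition bounded_on f (r M : R) := forall c, normc (f c) * r ^+ Defs.mdeg c <= M.

Lemma bounded_ge0 f r M : bounded_on f r M -> 0 <= M.
Proof.
by move/(_ (mi0 n)); rewrite mi_mdeg0 mulr1; apply: le_trans; apply: normc_ge0.
Qed.

Lemma bounded_shrink f r s M : 0 < s -> s <= r -> bounded_on f r M -> bounded_on f s M.
Proof.
move=> s0 sr H c; apply: le_trans (H c); apply: ler_wpM2l; first exact: normc_ge0.
by apply: lerXn2r; rewrite // nnegrE; lra.
Qed.

Lemma conv_pair f g : ps_conv f -> ps_conv g ->
  exists2 r : R, 0 < r & exists Mf Mg, bounded_on f r Mf /\ bounded_on g r Mg.
Proof.
move=> [r [r0 [M Hf]]] [s [s0 [M' Hg]]]; exists (Num.min r s); first by rewrite lt_min r0.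
by exists M, M'; split; [move: Hf|move: Hg]; apply: bounded_shrink; rewrite ?lt_min ?r0 ?s0 ?ge_min ?lexx ?orbT.
Qed.

Lemma conv_le f (c0 : R) g : (forall c, normc (g c) <= normc (f c) * c0) -> ps_conv f -> ps_conv g.
Proof.
move=> fg [r [r0 [M H]]]; exists r; split=> //; exists (M * `|c0|) => c.
apply: (@le_trans _ _ (normc (f c) * c0 * r ^+ Defs.mdeg c)).
  by rewrite ler_wpM2r // exprn_ge0 // ltW.
rewrite mulrAC; apply: (@le_trans _ _ (normc (f c) * r ^+ Defs.mdeg c * `|c0|)).
  by rewrite ler_wpM2l ?ler_norm // mulr_ge0 ?normc_ge0 ?exprn_ge0 // ltW.
by rewrite ler_wpM2r.
Qed.

Lemma conv_mask (P : pred (mi n)) f : ps_conv f -> ps_conv (fun c => if P c then f c else 0).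
Proof.
apply: (@conv_le _ 1) => c; rewrite mulr1; case: ifP => // _.
by rewrite normc0 normc_ge0.
Qed.

Lemma conv0 : ps_conv (0 : fps).
Proof.
by exists 1; split=> //; exists 0 => c; rewrite normc0 mul0r.
Qed.

Lemma convN f : ps_conv f -> ps_conv (- f).
Proof. by apply: (@conv_le _ 1) => c; rewrite mulr1 normcN. Qed.

Lemma convD f g : ps_conv f -> ps_conv g -> ps_conv (f + g).
Proof.
move=> cf cg; have [r r0 [M [M' [Hf Hg]]]] := conv_pair cf cg.
exists r; split=> //; exists (M + M') => c; apply: le_trans (lerD (Hf c) (Hg c)).
by rewrite -mulrDl ler_wpM2r ?le_normcD // exprn_ge0 // ltW.
Qed.

Lemma convB f g : ps_conv f -> ps_conv g -> ps_conv (f - g).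
Proof. by move=> cf cg; apply/convD/convN. Qed.

Lemma conv_sum (I : Type) (s : seq I) (P : pred I) (F : I -> fps) :
  (forall i, P i -> ps_conv (F i)) -> ps_conv (\sum_(i <- s | P i) F i).
Proof. by move=> H; elim/big_ind: _ => //; [apply: conv0|apply: convD]. Qed.

Lemma succ_le_exp2 k : (k.+1 <= 2 ^ k)%N.
Proof. exact: ltn_expl. Qed.

(** The product of the c_i + 1 is at most 2^|c|, so halving the radius absorbs the number of terms
    of a Cauchy product. *)
Lemma card_mi_le (c : mi n) :
  (#|[pred b : {ffun 'I_n -> 'I_(Defs.mdeg c).+1} | [forall i, (b i <= c i)%N]]| <= 2 ^ Defs.mdeg c)%N.
Proof.
pose F (i : 'I_n) := [pred k : 'I_(Defs.mdeg c).+1 | (k <= c i)%N].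
rewrite (@eq_card _ _ (family F)); last by move=> b; rewrite !inE; apply: eq_forallb.
rewrite card_family foldrE big_map big_enum /= /Defs.mdeg expn_sum.
apply: leq_prod => i _; apply: leq_trans (succ_le_exp2 _).
rewrite -sum1_card (eq_bigl (fun k : 'I_(Defs.mdeg c).+1 => (k < (c i).+1)%N)) //.
by rewrite -(big_ord_widen (Defs.mdeg c).+1 (fun=> 1%N)) ?ltnS ?mi_le_mdeg // sum1_card card_ord.
Qed.

Lemma convM f g : ps_conv f -> ps_conv g -> ps_conv (f * g).
Proof.
move=> cf cg; have [r r0 [M [M' [Hf Hg]]]] := conv_pair cf cg.
exists (r / 2); split; first lra.
exists (M * M') => c.
have M0 := bounded_ge0 Hf; have M'0 := bounded_ge0 Hg.
rewrite exprMn mulrA exprVn ler_pdivrMr ?exprn_gt0 //.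
have -> : (f * g) c = ps_mul f g c by [].
apply: (@le_trans _ _ (\sum_(b : {ffun 'I_n -> 'I_(Defs.mdeg c).+1} | [forall i, (b i <= c i)%N]) M * M')).
  apply: le_trans (ler_wpM2r _ (le_normc_sum _ _ _)) _; first by rewrite exprn_ge0 // ltW.
  rewrite mulr_suml; apply: ler_sum => b /forallP bc; rewrite normcM.
  set b1 := [ffun i => nat_of_ord (b i)]; set b2 := [ffun i => (c i - b i)%N].
  have -> : Defs.mdeg c = (Defs.mdeg b1 + Defs.mdeg b2)%N.
    by rewrite /Defs.mdeg -big_split /=; apply: eq_bigr => i _; rewrite !ffunE subnKC.
  rewrite exprD mulrACA; have r_ge0 := ltW r0.
  by apply: ler_pM; rewrite ?mulr_ge0 ?normc_ge0 ?exprn_ge0.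
rewrite sumr_const -[_ *+ #|_|]mulr_natr; apply: ler_wpM2l; first by rewrite mulr_ge0.
by rewrite -natrX ler_nat card_mi_le.
Qed.

Lemma conv_shift (m : multinom n) f : ps_conv f -> ps_conv (fun c => f (to_mi (mnm_add (of_mi c) m))).
Proof.
move=> [r [r0 [M H]]]; exists r; split=> //; exists (M / r ^+ mdeg m) => c.
rewrite ler_pdivlMr ?exprn_gt0 //; apply: le_trans (H (to_mi (mnm_add (of_mi c) m))).
by rewrite -(mdeg_of_mi (to_mi _)) to_miK mdegD mdeg_of_mi exprD mulrA.
Qed.

Lemma conv_deriv i f : ps_conv f -> ps_conv (ps_deriv i f).
Proof.
move=> /(conv_shift (mnm1 i)) [r [r0 [M H]]]; exists (r / 2); split; first lra.
exists M => c; rewrite exprMn mulrA exprVn ler_pdivrMr ?exprn_gt0 //.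
rewrite /ps_deriv normcM normc_nat.
have -> : [ffun j => (c j + (j == i))%N] = to_mi (mnm_add (of_mi c) (mnm1 i)).
  by apply/ffunP => j; rewrite !ffunE mnmDE of_miE mnm1E eq_sym.
rewrite -mulrA mulrC; apply: ler_pM => //; first by rewrite mulr_ge0 ?normc_ge0 ?exprn_ge0 // ltW.
rewrite -natrX ler_nat; apply: leq_trans (succ_le_exp2 _) _.
by rewrite leq_exp2l // mi_le_mdeg.
Qed.

Lemma conv_ps_of p : ps_conv (ps_of p : fps).
Proof.
exists 1; split=> //; exists (\sum_(m <- msupp p) normc (mcoeff m p)) => c.
rewrite expr1n mulr1 /ps_of; have [cp|/memN_msupp_eq0 ->] := boolP (of_mi c \in msupp p).
  by rewrite (big_rem _ cp) /= lerDl; apply: sumr_ge0 => *; apply: normc_ge0.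
by rewrite normc0; apply: sumr_ge0 => *; apply: normc_ge0.
Qed.

Lemma conv1 : ps_conv (1 : fps).
Proof. by rewrite -(rmorph1 (@ps_of R n)); apply: conv_ps_of. Qed.

Lemma convX f k : ps_conv f -> ps_conv (f ^+ k).
Proof. by move=> cf; elim: k => [|k IH]; rewrite ?exprS; [apply: conv1|apply: convM]. Qed.

Definition var i : fps := ps_of (mpolyX C (mnm1 i)).
Definition cst (a : C) : fps := ps_of (mpolyC n a).

Lemma conv_cst a : ps_conv (cst a).
Proof. exact: conv_ps_of. Qed.

Lemma cst0 : cst 0 = 0. Proof. by rewrite /cst !rmorph0. Qed.
Lemma cst1 : cst 1 = 1. Proof. by rewrite /cst !rmorph1. Qed.
Lemma cstN a : cst (- a) = - cst a. Proof. by rewrite /cst !rmorphN. Qed.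
Lemma cstD a b : cst (a + b) = cst a + cst b. Proof. by rewrite /cst !rmorphD. Qed.
Lemma cstM a b : cst (a * b) = cst a * cst b. Proof. by rewrite /cst !rmorphM. Qed.

(** The geometric series - sum_k x_i^k / a^(k+1), bounded on the radius |a|. *)
Lemma var_sub_cst_inv i (a : C) : a != 0 -> exists2 h : fps, ps_conv h & (var i - cst a) * h = 1.
Proof.
move=> a0; pose h : fps := fun c => if [forall j, (j != i) ==> (c j == 0%N)] then - a ^- (c i).+1 else 0.
have na : normc a != 0 by apply: contra a0 => /eqP/eq0_normc ->.
have na0 : 0 < normc a by rewrite lt_def na normc_ge0.
have hdeg (c : mi n) : [forall j, (j != i) ==> (c j == 0%N)] -> Defs.mdeg c = c i.
  move=> /forallP H; rewrite /Defs.mdeg (bigD1 i) //= big1 ?addn0 // => j ji.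
  by apply/eqP; have := H j; rewrite ji.
exists h.
  exists (normc a); split=> //; exists (normc a)^-1 => c; rewrite /h.
  case: ifP => [/hdeg ->|_]; last by rewrite normc0 mul0r invr_ge0 ltW.
  rewrite normcN normcV normcX exprS invfM -mulrA mulVf ?mulr1 // expf_neq0 //.
apply/funext => c; rewrite mulrBl fpsD fpsN ps_ofC ps_ofXM.
have -> : (1 : fps) c = (Defs.mdeg c == 0%N)%:R by [].
have E : [forall j, (j != i) ==> (to_mi (mnm_sub (of_mi c) (mnm1 i)) j == 0%N)] =
         [forall j, (j != i) ==> (c j == 0%N)].
  apply: eq_forallb => j; rewrite ffunE mnmBE of_miE mnm1E.
  by rewrite [i == j]eq_sym; case: (j == i) => //=; rewrite subn0.
have hd := hdeg c; rewrite {hdeg}/h E ffunE mnmBE of_miE mnm1E eqxx.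
have -> : lem (mnm1 i) (of_mi c) = (0 < c i)%N.
  apply/mnm_lepP/idP => [/(_ i)|ci j]; rewrite mnm1E of_miE ?eqxx //.
  by case: eqP => // <-.
move: hd {E}; set b := [forall j, _ ==> (c j == 0%N)].
case: (boolP b) => [_ /(_ isT) ->|/negP ch _].
  case: posnP => [->|ci] /=; first by rewrite expr1 mulrN opprK add0r divff.
  rewrite subn1 prednK // exprS invfM mulrN opprK mulrA divff // mul1r.
  by rewrite addNr.
rewrite if_same mulr0 subr0; case: eqP => // c0; case: ch; apply/forallP => j.
by apply/implyP => _; rewrite -leqn0 -c0 mi_le_mdeg.
Qed.
End Conv.

(** * Ideals of finite codimension *)

Section Ideals.
Variables (R : realType) (n : nat).
Local Notation C := R[i].
Local Notation fps := (fps R n).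
Local Notation cst := (@cst R n).
Implicit Types (f g h : fps) (J : fps -> Prop).

Definition conv_ideal J := [/\ J 0, (forall g h, J g -> J h -> J (g + h))
  & forall (a : fps) g, ps_conv a -> J g -> J (a * g)].

Lemma conv_idealN J g : conv_ideal J -> J g -> J (- g).
Proof.
move=> [_ _ JM] Jg; rewrite -mulN1r -cst1 -cstN.
apply: JM => //; exact: conv_cst.
Qed.

Lemma conv_idealB J g h : conv_ideal J -> J g -> J h -> J (g - h).
Proof. by move=> JI; have [_ JD _] := JI => Jg Jh; apply: JD => //; apply: conv_idealN. Qed.

Lemma conv_ideal_sum J (I : Type) (s : seq I) (P : pred I) (F : I -> fps) :
  conv_ideal J -> (forall i, P i -> J (F i)) -> J (\sum_(i <- s | P i) F i).
Proof. by move=> [J0 JD _] H; elim/big_ind: _. Qed.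

(** Coordinates modulo J in a basis [e] of the quotient. [pi] is a total function, but its laws are
    asserted only for convergent series. *)
Record coordinates J d (e : 'I_d -> fps) (pi : fps -> 'rV[C]_d) : Prop := {
  coord_conv : forall k, ps_conv (e k);
  coord_rem : forall g, ps_conv g -> J (g - \sum_k cst (pi g 0 k) * e k);
  coord0 : forall g, ps_conv g -> J g <-> pi g = 0;
  coordD : forall g h, ps_conv g -> ps_conv h -> pi (g + h) = pi g + pi h;
  coordZ : forall a g, ps_conv g -> pi (cst a * g) = a *: pi g;
  coord_basis : forall k, pi (e k) = delta_mx 0 k }.

Lemma lin_combE d (e : 'I_d -> fps) (x : 'I_d -> C) :
  (fun c => \sum_k x k * e k c) = \sum_k cst (x k) * e k.
Proof. by apply/funext => c; rewrite fps_sum; apply: eq_bigr => k _; rewrite ps_ofC. Qed.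

Lemma conv_comb d (e : 'I_d -> fps) (x : 'I_d -> C) :
  (forall k, ps_conv (e k)) -> ps_conv (\sum_k cst (x k) * e k).
Proof. by move=> H; apply: conv_sum => k _; apply: convM => //; apply: conv_cst. Qed.

Lemma exists_coordinates J d : conv_ideal J -> quot_dim J d ->
  exists e pi, @coordinates J d e pi.
Proof.
move=> JI [e [econv [span free]]]; have [J0 JD JM] := JI.
have {}span g : exists v : 'rV[C]_d, ps_conv g -> J (g - \sum_k cst (v 0 k) * e k).
  have [cg|ncg] := pselect (ps_conv g); last by exists 0.
  have [x Hx] := span g cg; exists (\row_k x k) => _.
  under eq_bigr do rewrite mxE; rewrite -lin_combE; exact: Hx.
have {}free (v : 'rV[C]_d) : J (\sum_k cst (v 0 k) * e k) -> v = 0.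
  by rewrite -lin_combE => /free H; apply/rowP => k; rewrite mxE H.
have [pi piP] := choice span.
have uniq g (v : 'rV[C]_d) : ps_conv g -> J (g - \sum_k cst (v 0 k) * e k) -> pi g = v.
  move=> cg Jv; apply/eqP; rewrite -subr_eq0; apply/eqP/free.
  have := conv_idealB JI Jv (piP g cg); congr J.
  rewrite opprB addrC addrA subrK -sumrB; apply: eq_bigr => k _.
  by rewrite -mulrBl !mxE cstD cstN.
exists e, pi; split=> //.
- move=> g cg; split=> [Jg|pg0].
    apply: uniq => //; rewrite big1 ?subr0 // => k _.
    by rewrite mxE cst0 mul0r.
  have := piP g cg; rewrite pg0 big1 ?subr0 // => k _.
  by rewrite mxE cst0 mul0r.
- move=> g h cg ch; apply: uniq; first exact: convD.
  have := JD _ _ (piP g cg) (piP h ch); congr J.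
  rewrite addrACA -opprD -big_split /=; congr (_ - _); apply: eq_bigr => k _.
  by rewrite -mulrDl mxE cstD.
- move=> a g cg; apply: uniq; first by apply: convM => //; apply: conv_cst.
  have := JM _ _ (conv_cst _ a) (piP g cg); congr J.
  rewrite mulrBr mulr_sumr; congr (_ - _); apply: eq_bigr => k _.
  by rewrite mulrA mxE cstM.
- move=> k; apply: uniq => //; rewrite (bigD1 k) //= mxE !eqxx /= cst1 mul1r big1 ?addr0 ?subrr //.
  by move=> l lk; rewrite mxE (negPf lk) andbF cst0 mul0r.
Qed.

Section Coord.
Variables (J : fps -> Prop) (d : nat) (e : 'I_d -> fps) (pi : fps -> 'rV[C]_d).
Hypotheses (JI : conv_ideal J) (piP : coordinates J e pi).

Lemma coord_sum (I : Type) (s : seq I) (F : I -> fps) :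
  (forall i, ps_conv (F i)) -> pi (\sum_(i <- s) F i) = \sum_(i <- s) pi (F i).
Proof.
move=> cF; elim: s => [|i s IH].
  by rewrite !big_nil; apply/(coord0 piP); [apply: conv0|case: JI].
by rewrite !big_cons (coordD piP) ?IH //; apply: conv_sum.
Qed.

Lemma coord_surj (v : 'rV[C]_d) : pi (\sum_k cst (v 0 k) * e k) = v.
Proof.
rewrite coord_sum => [|k]; last by apply: convM; [apply: conv_cst|apply: coord_conv piP _].
rewrite [RHS]row_sum_delta; apply: eq_bigr => k _.
by rewrite (coordZ piP) ?(coord_basis piP) //; apply: coord_conv piP _.
Qed.

(** Factors with a != 0 are units of the ring of convergent series and may be exchanged for x_i. *)
Lemma var_factor_ideal i (s : seq C) g : ps_conv g ->
  J (\prod_(a <- s) (var R i - cst a) * g) -> J (var R i ^+ size s * g).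
Proof.
have [_ _ JM] := JI; have cv : ps_conv (var R i) by exact: conv_ps_of.
elim: s g => [|a s IH] g cg; first by rewrite big_nil.
rewrite big_cons -mulrA mulrCA => /IH H; have [a0|a0] := eqVneq a 0.
  have := H (convM (convB cv (conv_cst _ a)) cg); congr J.
  by rewrite a0 cst0 subr0 /= exprSr mulrA.
have [h ch E] := var_sub_cst_inv i a0.
have -> : var R i ^+ size (a :: s) * g = (h * var R i) * (var R i ^+ size s * ((var R i - cst a) * g)).
  rewrite /= exprS -[LHS]mul1r -E; ring.
apply: JM; first exact: convM.
by apply: H; apply: convM => //; apply/convB/conv_cst.
Qed.

(** The d + 1 powers 1, ..., x_i^d are linearly dependent modulo J, so J contains a nonzero
    polynomial in x_i, which splits over the complex numbers. *)
Lemma var_pow_ideal i : exists a, J (var R i ^+ a).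
Proof.
have cv : ps_conv (var R i) by exact: conv_ps_of.
pose A : 'M[C]_(d.+1, d) := \matrix_k pi (var R i ^+ k).
have [v v0 vA] : exists2 v : 'rV[C]_d.+1, v != 0 & v *m A = 0.
  have kA : kermx A != 0.
    by rewrite kermx_eq0 /row_free neq_ltn (leq_ltn_trans (rank_leq_col A)).
  have [k Hk] : exists k, row k (kermx A) != 0.
    by apply/existsP; move: kA; apply: contraR; rewrite negb_exists => /forallP H;
       apply/eqP/row_matrixP => k; rewrite row0; apply/eqP; have := H k; rewrite negbK.
  by exists (row k (kermx A)); rewrite // -row_mul mulmx_ker row0.
pose p := \poly_(k < d.+1) v 0 (inord k).
have p0 : p != 0.
  apply: contra v0 => /eqP p0; apply/eqP/rowP => k; have := congr1 (fun q : {poly C} => q`_k) p0.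
  by rewrite coef_poly ltn_ord inord_val coef0 mxE.
have Jp : J (\sum_(k < d.+1) cst (v 0 k) * var R i ^+ k).
  have cc k : ps_conv (cst (v 0 k) * var R i ^+ k).
    by apply: convM; [apply: conv_cst|apply: convX].
  apply/(coord0 piP); first exact: conv_sum.
  rewrite coord_sum // -{}[RHS]vA mulmx_sum_row; apply: eq_bigr => k _.
  by rewrite (coordZ piP) ?rowK //; apply: convX.
have [s ps] := closed_field_poly_normal p.
exists (size s); rewrite -[_ ^+ _]mulr1; apply: var_factor_ideal; first exact: conv1.
have [_ _ JM] := JI; have lp : lead_coef p != 0 by rewrite lead_coef_eq0.
have := JM _ _ (conv_cst _ (lead_coef p)^-1) Jp; congr J; rewrite mulr1.
have [phi phiE] : exists phi : {rmorphism C -> fps}, forall a, phi a = cst a.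
  by exists (@ps_of R n \o @mpolyC n C).
have -> : \sum_(k < d.+1) cst (v 0 k) * var R i ^+ k = (map_poly phi p).[var R i].
  rewrite (@horner_coef_wide _ d.+1); last by rewrite (leq_trans (size_poly _ _)) ?size_poly.
  by apply: eq_bigr => k _; rewrite coef_map /= phiE coef_poly ltn_ord inord_val.
rewrite {2}ps map_polyZ hornerZ mulrA phiE -cstM mulVf // cst1 mul1r.
rewrite rmorph_prod horner_prod; apply: eq_bigr => a _.
by rewrite rmorphB /= map_polyX map_polyC !hornerE /= phiE.
Qed.
End Coord.

Definition fps_ge N g := forall c, (Defs.mdeg c < N)%N -> g c = 0.

Lemma fps_geD N g h : fps_ge N g -> fps_ge N h -> fps_ge N (g + h).
Proof. by move=> Hg Hh c cN; rewrite fpsD Hg ?Hh ?addr0. Qed.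

Lemma fps_geM N g h : fps_ge N h -> fps_ge N (g * h).
Proof.
move=> Hh c cN; rewrite (fpsM_trunc _ _ cN).
suff -> : trunc N h = 0 by rewrite mulr0 mcoeff0.
rewrite /trunc big1 // => m _; rewrite Hh ?scale0r //.
by rewrite -mdeg_of_mi to_miK bmdeg.
Qed.

Lemma fps_ge_sum N (I : Type) (s : seq I) (P : pred I) (F : I -> fps) :
  (forall i, P i -> fps_ge N (F i)) -> fps_ge N (\sum_(i <- s | P i) F i).
Proof. by move=> H c cN; rewrite fps_sum big1 // => i Pi; apply: H. Qed.

(** Every monomial of [g] has some exponent c_i >= a_i. [pick] assigns it to a single such i, so [g]
    splits explicitly into multiples of the x_i^(a_i) whose quotients are shifted masks of [g],
    hence convergent. *)
Lemma high_order_ideal J (a : 'I_n -> nat) g : conv_ideal J ->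
  (forall i, J (var R i ^+ a i)) -> ps_conv g -> fps_ge (\sum_i a i).+1 g -> J g.
Proof.
move=> JI Ja cg gN; have [_ _ JM] := JI.
pose P i (c : mi n) := [pick j | (a j <= c j)%N] == Some i.
pose gi i : fps := fun c => (fun c' => if P i c' then g c' else 0) (to_mi (mnm_add (of_mi c) (mnm_muln (mnm1 i) (a i)))).
have -> : g = \sum_i gi i * var R i ^+ a i.
  apply/funext => c; rewrite fps_sum.
  transitivity (\sum_i if P i c then g c else 0).
    rewrite -big_mkcond /= /P; case: pickP => [j ac|ac].
      by rewrite (big_pred1 j) // => i; rewrite eq_sym; apply/eqP/eqP => [[]|->].
    rewrite big_pred0 // gN // ltnS; apply: leq_sum => i _.
    by rewrite ltnW // ltnNge ac.
  apply: eq_bigr => i _; rewrite mulrC /var -rmorphXn /= mpolyXn ps_ofXM.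
  case: (boolP (lem _ _)) => [ac|/negP ac].
    rewrite /gi to_miK; have -> : mnm_add (mnm_sub (of_mi c) (mnm_muln (mnm1 i) (a i))) (mnm_muln (mnm1 i) (a i)) = of_mi c.
      exact: submK.
    by rewrite of_miK.
  case: ifP => //; rewrite /P; case: pickP => // j acj /eqP [ij]; case: ac.
  apply/mnm_lepP => k; rewrite mulmnE mnm1E of_miE -ij.
  by case: eqP => [<-|]; rewrite ?mul1n.
apply: conv_ideal_sum => // i _; apply: JM => //.
exact/conv_shift/conv_mask.
Qed.
End Ideals.

(** * Milnor and Tjurina algebras *)

Section Milnor.
Variables (R : realType) (n : nat).
Local Notation C := R[i].
Local Notation fps := (fps R n).
Local Notation cst := (@cst R n).
Variable f : fps.
Implicit Types g h : fps.
Local Notation D i := (ps_deriv i f : fps).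
Local Notation J := (@jac_ideal R n f : fps -> Prop).
Local Notation T := (@tjurina_ideal R n f : fps -> Prop).

Lemma jac_idealP g : J g <-> exists h : 'I_n -> fps, (forall i, ps_conv (h i)) /\ g = \sum_i h i * D i.
Proof.
split=> -[h [ch E]]; exists h; split=> //; first by apply/funext => c; rewrite fps_sum E.
by move=> c; rewrite E fps_sum.
Qed.

Lemma tjurina_idealP g : T g <-> exists2 h : fps, ps_conv h & J (g - h * f).
Proof.
split=> [[h [h0 [ch [ch0 E]]]]|[h0 ch0 /jac_idealP [h [ch E]]]].
  exists h0 => //; apply/jac_idealP; exists h; split=> //.
  by apply/funext => c; rewrite fpsD fpsN E fps_sum addrK.
exists h, h0; do !split=> //; move=> c; have := congr1 (fun g => g c) E.
by rewrite fps_sum => <-; rewrite fpsD fpsN subrK.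
Qed.

Lemma conv_ideal_jac : conv_ideal J.
Proof.
split.
- by apply/jac_idealP; exists (fun=> 0); split=> [_|]; [apply: conv0|rewrite big1 // => i _; rewrite mul0r].
- move=> g g' /jac_idealP [h [ch ->]] /jac_idealP [h' [ch' ->]]; apply/jac_idealP.
  exists (fun i => h i + h' i); split=> [i|]; first exact: convD.
  by rewrite -big_split; apply: eq_bigr => i _; rewrite mulrDl.
move=> a g ca /jac_idealP [h [ch ->]]; apply/jac_idealP.
exists (fun i => a * h i); split=> [i|]; first exact: convM.
by rewrite mulr_sumr; apply: eq_bigr => i _; rewrite mulrA.
Qed.

Lemma conv_ideal_tjurina : conv_ideal T.
Proof.
have [J0 JD JM] := conv_ideal_jac; split.
- by apply/tjurina_idealP; exists 0; [apply: conv0|rewrite mul0r subr0].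
- move=> g g' /tjurina_idealP [h ch Jh] /tjurina_idealP [h' ch' Jh']; apply/tjurina_idealP.
  exists (h + h'); first exact: convD.
  by rewrite mulrDl opprD addrACA; apply: JD.
move=> a g ca /tjurina_idealP [h ch Jh]; apply/tjurina_idealP.
exists (a * h); first exact: convM.
by rewrite -mulrA -mulrBr; apply: JM.
Qed.

Lemma trunc_deriv i d : fps_ge d (D i - ps_of (mderiv i (trunc d.+1 f))).
Proof.
move=> c cd; rewrite fpsD fpsN /ps_of mcoeff_deriv /ps_deriv.
have -> : [ffun j => (c j + (j == i))%N] = to_mi (mnm_add (of_mi c) (mnm1 i)).
  by apply/ffunP => j; rewrite !ffunE mnmDE of_miE mnm1E eq_sym.
rewrite -[X in mcoeff X _]to_miK.
set c' := to_mi _.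
have cd' : (Defs.mdeg c' < d.+1)%N by rewrite -mdeg_of_mi to_miK mdegD mdeg1 mdeg_of_mi addn1.
by rewrite mcoeff_trunc // of_miE mulr_natl subrr.
Qed.

Hypotheses (n_gt0 : (0 < n)%N) (f_conv : ps_conv f) (f0 : f (mi0 n) = 0).

Lemma exp_in_jac mu : quot_dim J mu -> J (f ^+ n).
Proof.
move=> qd; have [e [pi piP]] := exists_coordinates conv_ideal_jac qd.
have [a Ja] := choice (var_pow_ideal conv_ideal_jac piP).
set N := (\sum_i a i).+1.
have tail g : ps_conv g -> fps_ge N g -> J g by apply: high_order_ideal Ja => //; apply: conv_ideal_jac.
(* The truncation keeps one degree more than N because differentiation loses one. *)
have F0 : mcoeff mnm0 (trunc N.+1 f) = 0.
  rewrite -f0 -(@mcoeff_trunc _ _ N.+1) ?mi_mdeg0 //.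
  by congr mcoeff; apply/mnmP => i; rewrite of_miE ffunE mnm0E.
have char0 k : k.+1%:R != 0 :> C by rewrite pnatr_eq0.
have [h hP] := pow_in_gradient_ideal char0 n_gt0 N F0.
have -> : f ^+ n = \sum_i ps_of (h i) * D i + (f ^+ n - \sum_i ps_of (h i) * D i).
  by rewrite addrC subrK.
have cD : ps_conv (\sum_i ps_of (h i) * D i).
  by apply: conv_sum => i _; apply: convM; [apply: conv_ps_of|apply: conv_deriv].
have [_ JD JM] := conv_ideal_jac; apply: JD.
  by apply/jac_idealP; exists (fun i => ps_of (h i)); split=> // i; apply: conv_ps_of.
apply: tail; first by apply: convB => //; apply: convX.
set F := trunc N.+1 f in hP F0.
(* Three errors of order at least N: truncating f in the power, the polynomial congruence, and
   truncating f in the partial derivatives. *)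
have -> : f ^+ n - \sum_i ps_of (h i) * D i =
   (f ^+ n - ps_of F ^+ n) + ps_of (F ^+ n - \sum_i h i * mderiv i F) +
   \sum_i (- ps_of (h i)) * (D i - ps_of (mderiv i F)).
  have -> : ps_of (F ^+ n - \sum_i h i * mderiv i F) =
     ps_of F ^+ n - \sum_i ps_of (h i) * ps_of (mderiv i F).
    by rewrite rmorphB rmorphXn [X in _ - X]rmorph_sum /=; congr (_ - _); apply: eq_bigr => i _; rewrite rmorphM.
  have -> : \sum_i - ps_of (h i) * (D i - ps_of (mderiv i F)) =
     \sum_i ps_of (h i) * ps_of (mderiv i F) - \sum_i ps_of (h i) * D i.
    by rewrite -sumrB; apply: eq_bigr => i _; ring.
  ring.
apply: fps_geD; first apply: fps_geD.
- rewrite subrXX mulrC; apply: fps_geM => c cN; rewrite fpsD fpsN /ps_of mcoeff_trunc ?subrr //.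
  exact: ltnW.
- by move=> c cN; rewrite /ps_of hP // mdeg_of_mi.
by apply: fps_ge_sum => i _; apply: fps_geM; apply: trunc_deriv.
Qed.

(** * Multiplication by f in coordinates *)

Section Tjurina.
Variables (m tau : nat).
Variables (e : 'I_m.+1 -> fps) (pi : fps -> 'rV[C]_m.+1).
Hypothesis piP : coordinates J e pi.
Hypothesis f_nil : J (f ^+ n).

Definition mul_mx : 'M[C]_m.+1 := \matrix_k pi (f * e k).

Lemma coordM g : ps_conv g -> pi (f * g) = pi g *m mul_mx.
Proof.
move=> cg; have [_ _ JM] := conv_ideal_jac; have ce := coord_conv piP.
pose g' : fps := \sum_k cst (pi g 0 k) * e k.
have cg' : ps_conv g' by apply: conv_comb.
have cfg' : ps_conv (f * g') by apply: convM.
rewrite -(subrK g' g) mulrDr (coordD piP) //; last by apply: convM => //; apply: convB.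
have -> : pi (f * (g - g')) = 0.
  by apply/(coord0 piP); [apply: convM => //; apply: convB|apply/JM/(coord_rem piP)].
have cfe k : ps_conv (f * e k) by apply: convM.
rewrite add0r subrK mulr_sumr (eq_bigr (fun k => cst (pi g 0 k) * (f * e k))); last first.
  by move=> k _; rewrite mulrCA.
rewrite (coord_sum conv_ideal_jac piP) => [|k]; last by apply: convM => //; apply: conv_cst.
by rewrite mulmx_sum_row; apply: eq_bigr => k _; rewrite (coordZ piP) // rowK.
Qed.

Lemma coordMX k g : ps_conv g -> pi (f ^+ k * g) = pi g *m mul_mx ^+ k.
Proof.
move=> cg; elim: k => [|k IH]; first by rewrite mul1r expr0 mulmx1.
rewrite exprS -mulrA coordM; last by apply: convM => //; apply: convX.
by rewrite IH [in RHS]exprSr mulmxA.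
Qed.

Lemma mul_mx_nil : mul_mx ^+ n = 0.
Proof.
have [_ _ JM] := conv_ideal_jac; have ce := coord_conv piP.
apply/row_matrixP => k; rewrite row0 rowE -(coord_basis piP) -coordMX //.
by apply/(coord0 piP); [apply: convM => //; apply: convX|rewrite mulrC; apply: JM].
Qed.

Lemma tjurina_coord g : ps_conv g -> T g <-> (pi g <= mul_mx)%MS.
Proof.
move=> cg; have ce := coord_conv piP; rewrite tjurina_idealP; split.
  move=> [h ch]; have chf : ps_conv (h * f) by apply: convM.
  move=> /(coord0 piP (convB cg chf)) E.
  rewrite -(subrK (h * f) g) (coordD piP) ?E; [|exact: convB|by []].
  by rewrite add0r mulrC coordM // submxMl.
move=> /submxP [v E]; exists (\sum_k cst (v 0 k) * e k); first exact: conv_comb.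
have cv : ps_conv (\sum_k cst (v 0 k) * e k) by apply: conv_comb.
have cfv : ps_conv (f * (\sum_k cst (v 0 k) * e k)) by apply: convM.
rewrite mulrC; apply/(coord0 piP); first exact: convB.
rewrite (coordD piP) ?E; [|by []|exact: convN].
rewrite -mulN1r -cst1 -cstN (coordZ piP) // coordM //.
by rewrite (coord_surj conv_ideal_jac piP) scaleN1r subrr.
Qed.

(** The Tjurina algebra is the cokernel of [mul_mx]: the rows of [E], the images of its basis, span
    a complement of the row space of [mul_mx]. The corank of a square matrix is its nullity. *)
Lemma tjurina_dim : quot_dim T tau -> tau = \rank (kermx mul_mx).
Proof.
move=> qd; have [e' [pi' piP']] := exists_coordinates conv_ideal_tjurina qd.
have ce' := coord_conv piP'.
pose E := \matrix_k pi (e' k).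
have piE (v : 'rV_tau) : pi (\sum_k cst (v 0 k) * e' k) = v *m E.
  rewrite (coord_sum conv_ideal_jac piP) => [|k]; last by apply: convM => //; apply: conv_cst.
  by rewrite mulmx_sum_row; apply: eq_bigr => k _; rewrite (coordZ piP) // rowK.
have free (v : 'rV_tau) : (v *m E <= mul_mx)%MS -> v = 0.
  rewrite -piE -tjurina_coord; last exact: conv_comb.
  by rewrite (coord0 piP') ?(coord_surj conv_ideal_tjurina piP') //; apply: conv_comb.
have rE : \rank E = tau.
  apply/eqP; rewrite -[_ == _]/(row_free E) -kermx_eq0; apply/eqP/row_matrixP => k.
  by rewrite row0; apply: free; rewrite -row_mul mulmx_ker row0 sub0mx.
have capE : (E :&: mul_mx = 0)%MS.
  apply/eqP; rewrite -submx0; apply/rV_subP => v; rewrite sub_capmx => /andP [/submxP [w ->]].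
  by move/free ->; rewrite mul0mx sub0mx.
have full : (E + mul_mx :=: 1%:M)%MS.
  apply/eqmxP; rewrite submx1 /=; apply/rV_subP => v _.
  pose g : fps := \sum_k cst (v 0 k) * e k.
  have cg : ps_conv g by apply: conv_comb; apply: coord_conv piP.
  have <- : pi g = v by apply: coord_surj conv_ideal_jac piP _.
  pose g' : fps := \sum_k cst (pi' g 0 k) * e' k; have cg' : ps_conv g' by apply: conv_comb.
  rewrite -(subrK g' g) (coordD piP) ?piE //; last exact: convB.
  rewrite addrC addmx_sub_adds ?submxMl //.
  by apply/tjurina_coord; [apply: convB|exact: coord_rem piP' _ cg].
have := mxrank_sum_cap E mul_mx; rewrite full mxrank1 capE mxrank0 addn0 rE => H.
by rewrite mxrank_ker [X in (X - _)%N]H addnK.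
Qed.

Lemma ker_eq_pow_coord : ker_eq_pow f <-> (kermx mul_mx :=: mul_mx ^+ n.-1)%MS.
Proof.
have ce := coord_conv piP.
have kerP g : ps_conv g -> J (f * g) <-> (pi g <= kermx mul_mx)%MS.
  move=> cg; rewrite (coord0 piP) ?coordM //; last exact: convM.
  by rewrite sub_kermx; split=> [->|/eqP].
have powP g : ps_conv g -> (exists h : fps, ps_conv h /\ J (g - h * f ^+ n.-1)) <->
    (pi g <= mul_mx ^+ n.-1)%MS.
  move=> cg; split=> [[h [ch]]|/submxP [v E]].
    have chf : ps_conv (h * f ^+ n.-1) by apply: convM => //; apply: convX.
    move/(coord0 piP (convB cg chf)) => E.
    rewrite -(subrK (h * f ^+ n.-1) g) (coordD piP) ?E; [|exact: convB|by []].
    by rewrite add0r mulrC coordMX // submxMl.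
  exists (\sum_k cst (v 0 k) * e k); have cv : ps_conv (\sum_k cst (v 0 k) * e k) by apply: conv_comb.
  have cfv : ps_conv (f ^+ n.-1 * (\sum_k cst (v 0 k) * e k)) by apply: convM => //; apply: convX.
  split=> //; rewrite mulrC; apply/(coord0 piP); first exact: convB.
  rewrite (coordD piP) ?E; [|by []|exact: convN].
  rewrite -mulN1r -cst1 -cstN (coordZ piP) // coordMX //.
  by rewrite (coord_surj conv_ideal_jac piP) scaleN1r subrr.
have kE g : (exists h, ps_conv h /\ jac_ideal f (fun c => g c - ps_mul h (ps_exp f n.-1) c)) <->
            (exists h : fps, ps_conv h /\ J (g - h * f ^+ n.-1)).
  by split=> -[h [ch Jh]]; exists h; split=> //; move: Jh; rewrite ps_expE.
split=> [H|H g cg].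
  have HP (v : 'rV[C]_m.+1) : (v <= kermx mul_mx)%MS = (v <= mul_mx ^+ n.-1)%MS.
    have cv : ps_conv (\sum_k cst (v 0 k) * e k) by apply: conv_comb.
    rewrite -(coord_surj conv_ideal_jac piP v); apply/idP/idP.
      by move/kerP => /(_ cv) /(H _ cv) /kE /powP; apply.
    by move/powP => /(_ cv) /kE /(H _ cv) /kerP; apply.
  by apply/eqmxP/andP; split; apply/rV_subP => v; rewrite HP.
rewrite kE powP // -H; exact: kerP.
Qed.

End Tjurina.
End Milnor.

Theorem theorem1p1 (R : realType) (n : nat) (f : ps R[i] n) (mu tau : nat) :
  (1 <= n)%N ->
  ps_conv f ->
  f (mi0 n) = 0 ->
  isolated_crit f ->
  quot_dim (@jac_ideal R n f) mu ->
  quot_dim (@tjurina_ideal R n f) tau ->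
  (mu%:R / tau%:R <= n%:R :> R) /\
  (mu%:R / tau%:R = n%:R :> R <-> ker_eq_pow f).
Proof.
move=> n_gt0 f_conv f0 [crit _] qdJ qdT.
(* All generators vanish at the origin: f by assumption, its partial derivatives because the origin
   is critical. Hence tau and mu are positive, which makes the quotient meaningful and mu of the
   form [m.+1] required by the matrix ring. *)
have T1 : ~ tjurina_ideal f (1 : fps R n).
  move=> [h [h0 [_ [_ /(_ (mi0 n))]]]].
  rewrite -/(fps_mul h0 f) [fps_mul h0 f _]fpsM0 f0 mulr0 addr0 big1 => [|i _].
    change ((Defs.mdeg (mi0 n) == 0%N)%:R = 0 :> R[i] -> False).
    by rewrite mi_mdeg0 => /eqP; rewrite oner_eq0.
  by rewrite [LHS]fpsM0 crit mulr0.
have J1 : ~ jac_ideal f (1 : fps R n).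
  by move=> J1; apply/T1/tjurina_idealP; exists 0; [apply: conv0|rewrite mul0r subr0].
have quot_dim_gt0 (I : fps R n -> Prop) d : conv_ideal I -> quot_dim I d -> ~ I 1 -> (0 < d)%N.
  case: d => // CI qd []; have [e [pi piP]] := exists_coordinates CI qd.
  by apply/(coord0 piP); [apply: conv1|apply/rowP => -[]].
have tau_gt0 := quot_dim_gt0 _ _ (conv_ideal_tjurina f) qdT T1.
case: mu qdJ => [|m] qdJ; first by have := quot_dim_gt0 _ _ (conv_ideal_jac f) qdJ J1.
have f_nil := exp_in_jac n_gt0 f_conv f0 qdJ.
have [e [pi piP]] := exists_coordinates (conv_ideal_jac f) qdJ.
have nil := mul_mx_nil f_conv piP f_nil.
have tauE := tjurina_dim f_conv piP qdT.
have tauR : 0 < tau%:R :> R by rewrite ltr0n.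
rewrite (ker_eq_pow_coord f_conv piP) -(nilpotent_dim_eq n_gt0 nil) -tauE; split.
  by rewrite ler_pdivrMr // -natrM ler_nat tauE; apply: nilpotent_dim_le nil.
split=> [/(canRL (mulfVK (lt0r_neq0 tauR)))|->]; last by rewrite natrM mulfK // lt0r_neq0.
by rewrite -natrM => /eqP; rewrite eqr_nat => /eqP.
Qed.
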